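(* Let $X\subset \mathbb{P}^n$ be an integral variety such that $X\nsubseteq \Delta_{n-1}$. Let $Y\subset \mathbb{P}^n$ be an integral curve such that $Y\nsubseteq \Delta_{n-1}$ and $Y$ is not contained in a binomial hypersurface. Then $$\dim X\star Y = \min \{n,\dim X+1\}.$$
   Context: $\mathbb{P}^n$ is the $n$-dimensional complex projective space with a fixed system of homogeneous coordinates $x_0,\dots ,x_n$. Set $H_i:=\{x_i=0\}$ for $i=0,\dots ,n$ and $\Delta_{n-1}:=H_0\cup\cdots\cup H_n$ (the union of all coordinate hyperplanes). Varieties here are closed subvarieties of $\mathbb{P}^n$. A binomial hypersurface is the zero locus in $\mathbb{P}^n$ of a homogeneous binomial $\alpha\, x_0^{a_0}\cdots x_n^{a_n}+\beta\, x_0^{b_0}\cdots x_n^{b_n}$, where $\alpha,\beta$ are arbitrary non-zero constants and the two monomials are distinct and of the same degree. Hadamard product of points: for $P=[p_0:\dots :p_n]$ and $Q=[q_0:\dots :q_n]$ in $\mathbb{P}^n$ with $p_iq_i\ne 0$ for at least one $i$, $P\star Q:=[p_0q_0:\dots :p_nq_n]\in\mathbb{P}^n$; if $p_iq_i=0$ for all $i$, $P\star Q$ is not defined. Hadamard product of varieties: let $X,Y\subset\mathbb{P}^n$ be irreducible subvarieties such that $P\star Q$ is well-defined for at least one $(P,Q)\in X\times Y$. Then it is well-defined on a non-empty Zariski open subset of $X\times Y$, and $X\star Y$ is the Zariski closure in $\mathbb{P}^n$ of the set of all well-defined products $P\star Q$ with $P\in X$, $Q\in Y$. *)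

(* Defs.v *)
From HB Require Import structures.
From mathcomp Require Import all_boot all_order all_algebra generic_quotient.
From mathcomp Require Import boolp classical_sets reals complex mpoly.

Set Implicit Arguments.
Unset Strict Implicit.
Unset Printing Implicit Defensive.

Import GRing.Theory.
Local Open Scope ring_scope.
Local Open Scope quotient_scope.
Local Open Scope classical_set_scope.

Section ProjectiveSpace.
Variables (K : fieldType) (n : nat).

Definition nzvec := {v : 'rV[K]_n.+1 | v != 0}.

(* Two non-zero vectors are proportional iff, as 1-row matrices, they have the
   same row space. *)
Definition proportional (u v : nzvec) : bool := (val u == val v)%MS.

Lemma proportional_equiv : equiv_class_of proportional.
Proof.
split=> [u|u v|v u w]; rewrite /proportional ?submx_refl //.
  by rewrite andbC.
case/andP=> uv vu /andP[vw wv].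
by rewrite (submx_trans uv vw) (submx_trans wv vu).
Qed.

Canonical proportional_equivRel := EquivRelPack proportional_equiv.

Definition projspace := {eq_quot proportional}.
HB.instance Definition _ := EqQuotient.on projspace.
HB.instance Definition _ := Choice.on projspace.

(* A chosen system of homogeneous coordinates of P; it is only meaningful up to
   a non-zero scalar, see [hcoord_pi]. *)
Definition hcoord (P : projspace) (i : 'I_n.+1) : K := val (repr P) 0 i.

Lemma hcoord_pi (v : nzvec) :
  exists2 c : K, c != 0 & forall i, hcoord (\pi_projspace v) i = c * val v 0 i.
Proof.
have /eqmodP : \pi_projspace (repr (\pi_projspace v)) = \pi_projspace v.
  by rewrite reprK.
case/andP=> /sub_rVP[c Ec] _; exists c; last by move=> i; rewrite /hcoord Ec mxE.
by apply: contraNneq (valP (repr (\pi_projspace v))) => c0; rewrite Ec c0 scale0r.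
Qed.

(* For homogeneous p this does not depend on the coordinates chosen for P, see
   [vanishes_pi]. *)
Definition vanishes (p : {mpoly K[n.+1]}) (P : projspace) : Prop :=
  p.@[hcoord P] = 0.

Lemma vanishes_pi (p : {mpoly K[n.+1]}) (v : nzvec) : p \is homog mdeg ->
  vanishes p (\pi_projspace v) <-> p.@[fun i => val v 0 i] = 0.
Proof.
case/homogP=> d /dhomogP hp; have [c c0 Ec] := hcoord_pi v.
have -> : vanishes p (\pi_projspace v)
    = (c ^+ d * p.@[fun i => val v 0 i] = 0).
  congr (_ = 0); rewrite !mevalE mulr_sumr; apply: eq_big_seq => m /hp <-.
  rewrite mulrCA; congr (_ * _).
  rewrite (eq_bigr _ (fun i _ => congr1 (fun x => x ^+ m i) (Ec i))).
  under eq_bigr => i _ do rewrite exprMn.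
  by rewrite big_split /= prodrXr -mdegE.
split=> [/eqP|->]; last by rewrite mulr0.
by rewrite mulf_eq0 expf_eq0 (negPf c0) andbF => /eqP.
Qed.

Definition zeros (S : set {mpoly K[n.+1]}) : set projspace :=
  [set P | forall p, S p -> vanishes p P].

Definition zariski_closed (A : set projspace) : Prop :=
  exists2 S : set {mpoly K[n.+1]},
    (forall p, S p -> p \is homog mdeg) & A = zeros S.

Definition zariski_closure (A : set projspace) : set projspace :=
  smallest zariski_closed A.

Definition irreducible (A : set projspace) : Prop :=
  A !=set0 /\
  forall B C, zariski_closed B -> zariski_closed C ->
    A `<=` B `|` C -> A `<=` B \/ A `<=` C.

Definition integral_variety (X : set projspace) : Prop :=
  zariski_closed X /\ irreducible X.

Definition chain (X : set projspace) (d : nat) (Z : nat -> set projspace) :=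
  [/\ forall i, (i <= d)%N -> integral_variety (Z i),
      forall i, (i < d)%N -> Z i `<` Z i.+1
    & Z d `<=` X].

Definition is_krull_dim (X : set projspace) (d : nat) : Prop :=
  (exists Z, chain X d Z) /\ forall e Z, chain X e Z -> (e <= d)%N.

(* Krull dimension of a closed set X; the default value 0 is only used when
   chains in X do not have a maximal length, i.e. for X empty. *)
Definition krull_dim (X : set projspace) : nat := xget 0%N (is_krull_dim X).

Definition integral_curve (Y : set projspace) : Prop :=
  integral_variety Y /\ krull_dim Y = 1%N.

Definition coord_hyperplane (i : 'I_n.+1) : set projspace :=
  [set P | hcoord P i = 0].

Definition coord_hyperplanes : set projspace :=
  \bigcup_i coord_hyperplane i.

Definition binomial_hypersurface (B : set projspace) : Prop :=
  exists (alpha beta : K) (a b : 'X_{1..n.+1}),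
    [/\ alpha != 0, beta != 0, a != b, mdeg a = mdeg b
      & B = zeros [set alpha *: 'X_[a] + beta *: 'X_[b]]].

(* [None] when all the products p_i q_i are 0. *)
Definition hadamard_pt (P Q : projspace) : option projspace :=
  omap \pi_projspace (insub (\row_i (hcoord P i * hcoord Q i)) : option nzvec).

Lemma hadamard_pt_pi (u v : nzvec) :
  hadamard_pt (\pi_projspace u) (\pi_projspace v)
  = omap \pi_projspace
      (insub (\row_i (val u 0 i * val v 0 i)) : option nzvec).
Proof.
have [c c0 Ec] := hcoord_pi u; have [d d0 Ed] := hcoord_pi v.
rewrite /hadamard_pt; set w := (X in _ = omap _ (insub X)).
have -> : \row_i (hcoord (\pi_projspace u) i * hcoord (\pi_projspace v) i)
    = (c * d) *: w.
  by apply/rowP=> i; rewrite !mxE Ec Ed mulrACA.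
have cd0 : c * d != 0 by rewrite mulf_neq0.
case: (boolP (w != 0)) => w0; last first.
  by rewrite !insubN // scaler_eq0 (negPf cd0).
have cw0 : (c * d) *: w != 0 by rewrite scaler_eq0 (negPf cd0).
rewrite !insubT /=; congr Some; apply/eqmodP; rewrite /= /proportional /=.
by apply/eqmxP/eqmx_scale.
Qed.

Definition hadamard (X Y : set projspace) : set projspace :=
  zariski_closure
    [set R | exists2 P, X P & exists2 Q, Y Q & hadamard_pt P Q = Some R].

End ProjectiveSpace.

Arguments coord_hyperplanes : clear implicits.

(* Complex projective space; the complex numbers are the algebraic closure
   R[i] of a complete Archimedean ordered field R. *)
Definition CP (R : realType) (n : nat) := projspace (R[i] : fieldType) n.

(* Main.v *)
(** The dimension of an irreducible closed set A is read off the growth of its Hilbert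
    function, the number of degree m forms that are linearly independent on A. A proper
    irreducible closed subset lowers the growth order, because F G, with F vanishing on
    the subset, only vanishes on A when G does; so the growth order bounds the length of
    chains. Conversely, projecting A from a point outside A, until a coordinate subspace
    is reached, preserves the growth order and lifts chains, so that A has a chain whose
    length is the growth order.

    A monomial at P * Q is the product of its values at P and at Q, so the Hilbert
    function of X * Y is at most the product of those of X and Y, and
    dim (X * Y) <= dim X + 1. If X is not the whole space and dim (X * Y) = dim X, then
    P * X = X * Y for all P in Y off the coordinate hyperplanes, hence every Q / P
    stabilizes X. A form vanishing on X with as few monomials as possible is then an
    eigenvector of the stabilizer, so two distinct monomials of the same degree agree on
    all the Q / P, and this is a binomial equation for Y. *)

From HB Require Import structures.
Require Import Defs.
From mathcomp Require Import all_boot all_order all_algebra.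
From mathcomp Require Import generic_quotient zify.
From mathcomp Require Import boolp classical_sets reals complex mpoly.

Local Open Scope classical_set_scope.

Section Dimension.
Local Open Scope ring_scope.
Local Open Scope quotient_scope.

Set Implicit Arguments.
Unset Strict Implicit.
Unset Printing Implicit Defensive.

Import GRing.Theory.

(** * Points, forms and closed sets *)

Section Points.
Variables (K : fieldType) (n : nat).
Local Notation V := 'rV[K]_n.+1.
Local Notation form := {mpoly K[n.+1]}.
Implicit Types (f g : form) (u v w : V) (A B C : set (projspace K n)).

Lemma homog_evalZ d f c v :
  f \is d.-homog -> f.@[(c *: v) 0] = c ^+ d * f.@[v 0].
Proof.
move=> /dhomogP hf; rewrite !mevalE mulr_sumr; apply: eq_big_seq => m /hf <-.
rewrite mulrCA; congr (_ * _).
under eq_bigr do rewrite mxE exprMn.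
by rewrite big_split /= prodrXr -mdegE.
Qed.

Lemma homog_eval0 d f : f \is d.-homog -> (0 < d)%N -> f.@[(0 : V) 0] = 0.
Proof.
by move=> hf d0; rewrite -(scale0r (0 : V)) (homog_evalZ _ _ hf) expr0n gtn_eqF // mul0r.
Qed.

Lemma homog0_const f u v : f \is 0.-homog -> f.@[u 0] = f.@[v 0].
Proof.
move=> hf; rewrite -[f.@[u 0]]mul1r -[f.@[v 0]]mul1r -(expr0 0).
by rewrite -!(homog_evalZ _ _ hf) !scale0r.
Qed.

Lemma const_mx1_neq0 : (const_mx 1 : V) != 0.
Proof. by apply/eqP => /rowP /(_ 0) /eqP; rewrite !mxE oner_eq0. Qed.

(* The value at 0 is junk. *)
Definition pt v : projspace K n :=
  \pi_(projspace K n) (insubd (exist (fun v : V =>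
    is_true (v != 0)) _ const_mx1_neq0 : nzvec K n) v).

Lemma pt_val (w : nzvec K n) : pt (val w) = \pi_(projspace K n) w.
Proof. by rewrite /pt valKd. Qed.

Lemma pt_repr P : pt (val (repr P)) = P.
Proof. by rewrite pt_val reprK. Qed.

Lemma pt_surj P : exists2 v, v != 0 & P = pt v.
Proof. by exists (val (repr P)); [exact: (valP (repr P)) | rewrite pt_repr]. Qed.

Lemma eq_pt u v : u != 0 -> v != 0 ->
  pt u = pt v <-> exists2 c, c != 0 & u = c *: v.
Proof.
move=> u0 v0; have ps := pt_val (Sub u u0 : nzvec K n); have pv := pt_val (Sub v v0 : nzvec K n).
rewrite ps pv; split => [/eqmodP|[c c0 uv]].
  case/andP => /sub_rVP[c /= Ec] _; exists c => //.
  by apply/eqP => c0; case/eqP: (u0); rewrite Ec c0 scale0r.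
by apply/eqmodP; rewrite /= /proportional /= uv; apply/eqmxP/eqmx_scale.
Qed.

Lemma scale_neq0 c v : c != 0 -> v != 0 -> c *: v != 0.
Proof. by move=> c0 v0; rewrite scaler_eq0 negb_or c0. Qed.

Lemma pt_scale c v : c != 0 -> v != 0 -> pt (c *: v) = pt v.
Proof. by move=> c0 v0; apply/eq_pt => //; [exact: scale_neq0 | exists c]. Qed.

Lemma hcoord_pt v : v != 0 -> exists2 c, c != 0 & forall i, hcoord (pt v) i = c * v 0 i.
Proof.
by move=> v0; have [c c0 Ec] := hcoord_pi (Sub v v0 : nzvec K n); exists c => // i;
  rewrite /pt /insubd insubT Ec.
Qed.

Lemma vanishes_pt d f v : f \is d.-homog -> v != 0 ->
  vanishes f (pt v) <-> f.@[v 0] = 0.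
Proof.
move=> hf v0; have := vanishes_pi (Sub v v0 : nzvec K n) (homogE hf).
by rewrite /pt /insubd insubT.
Qed.

Definition vanishes_on f A := forall v, v != 0 -> A (pt v) -> f.@[v 0] = 0.

Lemma not_vanishes_on f A : ~ vanishes_on f A ->
  exists v, [/\ v != 0, A (pt v) & f.@[v 0] != 0].
Proof.
move=> nf; apply: contrapT => H; apply: nf => v v0 Av; apply/eqP.
by apply: contra_notT H => fv; exists v.
Qed.

Lemma zeros_pt (S : set form) v : (forall f, S f -> f \is homog mdeg) -> v != 0 ->
  zeros S (pt v) <-> forall f, S f -> f.@[v 0] = 0.
Proof.
move=> hS v0; split=> H f Sf; have /homogP[d hf] := hS _ Sf.
  by apply/(vanishes_pt hf v0)/H.
by apply/(vanishes_pt hf v0)/H.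
Qed.

Lemma set_ptP A B : (forall v, v != 0 -> A (pt v) <-> B (pt v)) -> A = B.
Proof.
move=> H; apply/seteqP; split=> P; have [v v0 ->] := pt_surj P;
  exact: (H v v0).1 || exact: (H v v0).2.
Qed.

Lemma subset_ptP A B : (forall v, v != 0 -> A (pt v) -> B (pt v)) -> A `<=` B.
Proof. by move=> H P; have [v v0 ->] := pt_surj P; exact: H. Qed.

Lemma not_subset_ptP A B : ~ (A `<=` B) ->
  exists v, [/\ v != 0, A (pt v) & ~ B (pt v)].
Proof.
move=> nf; apply: contrapT => H; apply: nf; apply: subset_ptP => v v0 Av.
by apply: contrapT => Bv; apply: H; exists v.
Qed.

Lemma separation A v : zariski_closed A -> v != 0 -> ~ A (pt v) ->
  exists d f, [/\ f \is d.-homog, vanishes_on f A & f.@[v 0] != 0].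
Proof.
case=> S hS -> v0 nA; apply: contrapT => H; apply: nA; apply/zeros_pt => // f Sf.
apply: contrapT => /eqP fv; apply: H; have /homogP[d hf] := hS _ Sf.
by exists d, f; split=> // w w0 /zeros_pt; apply.
Qed.

Hypothesis Kclosed : forall p : {poly K}, size p != 1 -> exists x, root p x.

(** For a non-constant p, the polynomial p - 1 has the same size, hence a root, and p takes the
    value 1 there. *)
Lemma ex_nonroot (p : {poly K}) : p != 0 -> exists x, p.[x] != 0.
Proof.
move=> p0; case: (eqVneq (size p) 1) => [/eqP/size_poly1P[c c0 ->]|s1].
  by exists 0; rewrite hornerC.
have s2 : (1 < size p)%N by move: s1 p0; rewrite -size_poly_gt0; case: (size p) => [|[]].
have : size (p - 1) != 1.
  by rewrite size_polyDl ?size_polyN ?size_poly1 //.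
case/Kclosed => x; rewrite /root !hornerE subr_eq0 => /eqP px; exists x.
by rewrite px oner_eq0.
Qed.

Lemma ex_nonroot_neq0 (p : {poly K}) : p != 0 -> exists2 x, x != 0 & p.[x] != 0.
Proof.
move=> p0; have [|x] := @ex_nonroot (p * 'X); first by rewrite mulf_neq0 ?polyX_eq0.
by rewrite hornerM hornerX mulf_eq0 negb_or => /andP[px x0]; exists x.
Qed.

(** Along the line through v, f becomes a polynomial in c whose coefficients are the values at v of
    the homogeneous components of f. It vanishes at all non-zero c, hence is zero. *)
Lemma homog_components_eq0 f v :
  (forall c, c != 0 -> f.@[(c *: v) 0] = 0) -> forall d, (pihomog mdeg d f).@[v 0] = 0.
Proof.
move=> H; pose k := msize f.
have Ef := pihomog_partitionE (mf := @mdeg n.+1 : measure _) (leqnn k).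
pose p : {poly K} := \poly_(d < k) (pihomog mdeg d f).@[v 0].
have p0 : p = 0.
  apply/eqP; apply: contraT => /ex_nonroot_neq0[c c0]; rewrite /p horner_poly.
  have := H _ c0; rewrite {1}Ef raddf_sum /= => E; rewrite -[X in _ != X]E => /eqP[].
  by apply: eq_bigr => d _; rewrite (homog_evalZ _ _ (pihomogP _ _ _)) mulrC.
move=> d; case: (ltnP d k) => dk; last first.
  suff -> : pihomog mdeg d f = 0 by rewrite raddf0.
  rewrite pihomogE big_seq_cond big_pred0 // => m; apply/negP => /andP[mf /eqP md].
  by have := msize_mdeg_lt mf; rewrite md ltnNge dk.
by have := congr1 (fun p : {poly K} => p`_d) p0; rewrite coef_poly dk coef0.
Qed.

(** Allows equations that are not homogeneous: the common zeros of S form a cone, so the homogeneous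
    components of the members of S vanish on it as well. *)
Lemma closedP A (S : set form) :
  (forall v, v != 0 -> A (pt v) <-> forall f, S f -> f.@[v 0] = 0) -> zariski_closed A.
Proof.
move=> H; have hS f : [set pihomog mdeg p.2 p.1 | p in [set p : form * nat | S p.1]] f -> f \is
  homog mdeg.
  by case=> p _ <-; exact: homogE (pihomogP _ _ _).
exists [set pihomog mdeg p.2 p.1 | p in [set p | S p.1]] => //.
apply: set_ptP => v v0; rewrite zeros_pt //; split.
  move=> Av _ [[f d] /= Sf <-]; apply: homog_components_eq0 => c c0.
  by have /(H _ (scale_neq0 c0 v0)) : A (pt (c *: v)) by [rewrite pt_scale]; apply.
move=> Z; apply/H => // f Sf.
rewrite [f](pihomog_partitionE (mf := @mdeg n.+1 : measure _) (leqnn _)) raddf_sum big1 //= =>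
  d _.
by apply: Z; exists (f, val d).
Qed.

Lemma closed_setT : zariski_closed [set: projspace K n].
Proof. by apply: (closedP (S := set0)). Qed.

Lemma closed_bigcap (I : Type) (D : set I) (F : I -> set (projspace K n)) :
  (forall i, D i -> zariski_closed (F i)) -> zariski_closed (\bigcap_(i in D) F i).
Proof.
move=> H; apply: (closedP (S := [set f | exists2 i, D i & vanishes_on f (F i)])) => v v0.
split=> [Av f [i Di]|Hf i Di]; first by apply => //; exact: Av.
apply: contrapT => /(separation (H _ Di) v0)[d [f [_ fF /eqP[]]]].
by apply: Hf; exists i.
Qed.

Lemma closedI A B : zariski_closed A -> zariski_closed B -> zariski_closed (A `&` B).
Proof. by move=> cA cB; rewrite -bigcap2E; apply: closed_bigcap => -[|[|i]] //= _;
  exact: closed_setT. Qed.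

Lemma closed_zero d f : f \is d.-homog ->
  exists2 B, zariski_closed B & forall v, v != 0 -> B (pt v) <-> f.@[v 0] = 0.
Proof.
move=> hf; have h g : [set f] g -> g \is homog mdeg by move=> ->; exact: homogE hf.
exists (zeros [set f]); first by exists [set f].
by move=> v v0; rewrite zeros_pt //; split=> [|fv g ->] //; apply.
Qed.

(** Irreducibility as primality of the homogeneous ideal. For the converse, a point of A outside B
    and one outside C yield forms that vanish on B and on C respectively; their product vanishes on
    A. *)
Lemma irreducibleP A : irreducible A <-> A !=set0 /\
  forall d e f g, f \is d.-homog -> g \is e.-homog ->
    vanishes_on (f * g) A -> vanishes_on f A \/ vanishes_on g A.
Proof.
split=> -[A0 H]; split=> //.
  move=> d e f g /closed_zero[B cB fB] /closed_zero[C cC gC] fg.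
  have [|AB|AC] := H B C cB cC.
  - apply: subset_ptP => v v0 Av; have /eqP := fg v v0 Av.
    by rewrite mevalM mulf_eq0 => /orP[/eqP /fB|/eqP /gC]; [left; auto|right; auto].
  - by left=> v v0 Av; apply/fB => //; exact: AB.
  - by right=> v v0 Av; apply/gC => //; exact: AC.
move=> B C cB cC ABC; apply: contrapT => /not_orP[].
move=> /not_subset_ptP[u [u0 Au /(separation cB u0)[d [f [hf fB fu]]]]].
move=> /not_subset_ptP[w [w0 Aw /(separation cC w0)[e [g [hg gC gw]]]]].
have [v v0 Av|fA|gA] := H d e f g hf hg.
- by rewrite mevalM; case: (ABC _ Av) => [/fB ->|/gC ->]; rewrite ?mul0r ?mulr0.
- by move: fu; rewrite fA ?eqxx.
- by move: gw; rewrite gA ?eqxx.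
Qed.

End Points.

(** * Hilbert functions *)

Lemma linear_dependence (K : fieldType) (I J : finType) (M : J -> I -> K) :
  (#|I| < #|J|)%N ->
  exists c : J -> K, (exists j, c j != 0) /\ forall i, \sum_j c j * M j i = 0.
Proof.
move=> IJ; pose A := \matrix_(j < #|J|, i < #|I|) M (enum_val j) (enum_val i).
have kA : kermx A != 0.
  rewrite kermx_eq0 /row_free neq_ltn (leq_ltn_trans (rank_leq_col A)) //.
have [u uK u0] := rowV0Pn kA; have uA := sub_kermxP uK.
exists (fun j => u 0 (enum_rank j)); split.
  apply: contrapT => H; case/eqP: u0; apply/rowP => k; rewrite !mxE.
  apply: contrapT => /eqP uk; apply: H; exists (enum_val k); by rewrite enum_valK.
move=> i; transitivity ((u *m A) 0 (enum_rank i)); last by rewrite uA mxE.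
rewrite mxE (reindex (@enum_val J predT)) /=; last by apply: onW_bij; exact: enum_val_bij.
by apply: eq_bigr => k _; rewrite enum_valK mxE enum_rankK.
Qed.

Section Hilbert.
Variables (K : fieldType) (n : nat).
Local Notation V := 'rV[K]_n.+1.
Local Notation form := {mpoly K[n.+1]}.
Implicit Types (f g : form) (u v w : V) (A B C : set (projspace K n)).

(** Used to attach forms to a form f, such as its pullback by a matrix or its Taylor coefficients,
    by treating only linear combinations and products with one variable. *)
Lemma homog_ind (P : nat -> form -> Prop) :
  P 0%N 1 -> (forall d, P d 0) ->
  (forall d c f g, f \is d.-homog -> g \is d.-homog -> P d f -> P d g -> P d (c *: f + g)) ->
  (forall d f i, f \is d.-homog -> P d f -> P d.+1 ('X_i * f)) ->
  forall d f, f \is d.-homog -> P d f.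
Proof.
move=> P1 P0 PD PX d f /dhomogP; rewrite {2}[f]mpolyE.
have PM k m : mdeg m = k -> P k 'X_[m].
  elim: k m => [|k IH] m mk.
    by move/eqP: mk; rewrite mdeg_eq0 => /eqP ->; rewrite mpolyX0.
  have [i mi] : exists i, (0 < m i)%N.
    apply: contrapT => H; have : mdeg m = 0%N; last by rewrite mk.
    rewrite mdegE big1 // => i _; apply/eqP; rewrite -leqn0 leqNgt.
    by apply/negP => mi; apply: H; exists i.
  have Em : m = (U_(i) + (m - U_(i)))%MM.
    apply/mnmP => j; rewrite mnmDE mnmBE mnm1E; case: eqP => [<-|] /=; lia.
  move: mk; rewrite Em mdegD mdeg1 add1n => -[mk]; rewrite mpolyXD.
  by apply: PX; [rewrite dhomogX; apply/eqP | apply: IH].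
elim: (msupp f) => [|m s IH] gd; first by by rewrite big_nil.
have hm : 'X_[K, m] \is d.-homog by rewrite dhomogX; apply/eqP/gd; rewrite inE eqxx.
rewrite big_cons; apply: PD => //.
- rewrite big_seq; apply: rpred_sum => i si; apply: rpredZ; rewrite dhomogX; apply/eqP/gd.
  by rewrite inE si orbT.
- by apply: PM; exact: gd (mem_head _ _).
- by apply: IH => i si; apply: gd; rewrite inE si orbT.
Qed.

Lemma homog_mulmx d f (M : 'M[K]_n.+1) : f \is d.-homog ->
  exists2 g, g \is d.-homog & forall v, g.@[v 0] = f.@[(v *m M) 0].
Proof.
move: d f; apply: homog_ind => [|d|d c f g _ _ [f' hf Ef] [g' hg Eg]|d f i _ [f' hf Ef]].
- by exists 1 => [|v]; rewrite ?dhomog1 ?rmorph1.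
- by exists 0 => [|v]; rewrite ?rpred0 ?rmorph0.
- exists (c *: f' + g') => [|v]; first by rewrite rpredD ?rpredZ.
  by rewrite !mevalD !mevalZ Ef Eg.
- exists ((\sum_j M j i *: 'X_j) * f') => [|v].
    rewrite -[d.+1]/(1 + d)%N; apply: dhomogM hf; apply: rpred_sum => j _; apply: rpredZ.
    by rewrite dhomogX; apply/eqP/mdeg1.
  rewrite !mevalM Ef mevalXU [in RHS]mxE raddf_sum /=; congr (_ * _).
  by apply: eq_bigr => j _; rewrite mevalZ mevalXU mulrC.
Qed.

Lemma vanishes_on_sub f A B : A `<=` B -> vanishes_on f B -> vanishes_on f A.
Proof. by move=> AB fB v v0 /AB; exact: fB. Qed.

Lemma vanishes_onMl f g A : vanishes_on g A -> vanishes_on (f * g) A.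
Proof. by move=> gA v v0 Av; rewrite mevalM gA // mulr0. Qed.

Lemma vanishes_onD f g A : vanishes_on f A -> vanishes_on g A -> vanishes_on (f + g) A.
Proof. by move=> fA gA v v0 Av; rewrite mevalD fA // gA // addr0. Qed.

Definition linearly_free A (I : finType) (F : I -> form) :=
  forall c : I -> K, vanishes_on (\sum_i c i *: F i) A -> forall i, c i = 0.

(* The Hilbert function of A takes a value at most N in degree m. *)
Definition hilbert_le A m N := exists (I : finType) (s : I -> form),
  [/\ (#|I| <= N)%N, forall i, s i \is m.-homog &
   forall f, f \is m.-homog -> exists c : I -> K, vanishes_on (f - \sum_i c i *: s i) A].

Lemma hilbert_le_free A m N (J : finType) (F : J -> form) : hilbert_le A m N ->
  (forall j, F j \is m.-homog) -> linearly_free A F -> (#|J| <= N)%N.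
Proof.
case=> I [s [cI hs sp]] hF fr; apply: leq_trans cI; rewrite leqNgt; apply/negP => IJ.
have /choice[M HM] j := sp _ (hF j).
have [c [[j cj] Ec]] := linear_dependence M IJ.
case/eqP: cj; apply: fr => v v0 Av; rewrite raddf_sum /=.
transitivity (\sum_j \sum_i c j * M j i * (s i).@[v 0]).
  apply: eq_bigr => k _; rewrite mevalZ; have /eqP := HM k v v0 Av.
  rewrite mevalB subr_eq0 => /eqP ->; rewrite raddf_sum mulr_sumr /=.
  by apply: eq_bigr => i _; rewrite mevalZ mulrA.
rewrite exchange_big big1 //= => i _; by rewrite -mulr_suml Ec mul0r.
Qed.

(** A free family of maximal size spans: if some f were not a combination of it on A, adding f would
    give a larger free family. *)
Lemma free_hilbert_le A m N :
  (forall r (F : 'I_r -> form), (forall i, F i \is m.-homog) -> linearly_free A F -> (r <= N)%N)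
    ->
  hilbert_le A m N.
Proof.
move=> H; pose Q r := `[< exists F : 'I_r -> form, (forall i, F i \is m.-homog) /\ linearly_free
  A F >].
have Q0 : exists r, Q r.
  by exists 0%N; apply/asboolP; exists (fun _ => 0); split=> [i|c _ []//]; exact: rpred0.
have QN r : Q r -> (r <= N)%N by move=> /asboolP[F [hF fr]]; exact: H hF fr.
case: (ex_maxnP Q0 QN) => r /asboolP[F [hF fr]] rmax.
exists 'I_r, F; split; rewrite ?card_ord //; first exact: H hF fr.
move=> f hf; pose F' (k : 'I_r.+1) := oapp F f (unlift ord0 k).
have hF' k : F' k \is m.-homog by rewrite /F'; case: (unlift _ _).
apply: contrapT => Hf.
have : Q r.+1; last by move/rmax; rewrite ltnn.
apply/asboolP; exists F'; split=> // c; rewrite big_ord_recl /F' unlift_none /=.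
under eq_bigr do rewrite liftK /=.
move=> cF; have c0 : c ord0 = 0.
  apply: contrapT => /eqP c0; apply: Hf; exists (fun i => - (c ord0)^-1 * c (lift ord0 i)) =>
    v v0 Av.
  have /(congr1 ( *%R (c ord0)^-1)) := cF v v0 Av;
    rewrite mulr0 [X in _ * X = _]mevalD mevalZ mulrDr mulKf // => E.
  rewrite mevalD -[RHS]E; congr (_ + _); rewrite mevalN !rmorph_sum mulr_sumr -sumrN /=.
  by apply: eq_bigr => i _; rewrite !mevalZ mulrA !mulNr opprK.
have {}cF : vanishes_on (\sum_i c (lift ord0 i) *: F i) A.
  by move: cF; rewrite c0 scale0r add0r.
by move=> k; case: (unliftP ord0 k) => [j ->|-> //]; exact: fr _ cF j.
Qed.

Lemma hilbert_le_sub A B m N : A `<=` B -> hilbert_le B m N -> hilbert_le A m N.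
Proof.
move=> AB [I [s [cI hs sp]]]; exists I, s; split=> // f /sp[c Hc]; exists c.
exact: vanishes_on_sub Hc.
Qed.

Lemma hilbert_le_leq A m N N' : (N <= N')%N -> hilbert_le A m N -> hilbert_le A m N'.
Proof. by move=> NN' [I [s [cI hs sp]]]; exists I, s; split=> //; exact: leq_trans NN'. Qed.

(** An upper bound of order d on the Hilbert function; chains of length d supply the opposite
    inequality. The base [m.+1] keeps the power of m non-zero in degree 0. *)
Definition hilbert_growth A d := exists k : nat, forall m, hilbert_le A m (k * m.+1 ^ d)%N.

Lemma irreducible_cancel d e f g A : irreducible A -> f \is d.-homog -> g \is e.-homog ->
  ~ vanishes_on f A -> vanishes_on (f * g) A -> vanishes_on g A.
Proof. by move=> /irreducibleP[_ H] hf hg nf /(H _ _ _ _ hf hg)[]. Qed.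

Lemma irreducible_cancelX d e k f g A : irreducible A -> f \is d.-homog -> g \is e.-homog ->
  ~ vanishes_on f A -> vanishes_on (f ^+ k * g) A -> vanishes_on g A.
Proof.
move=> iA hf hg nf; elim: k => [|k IH]; first by rewrite expr0 mul1r.
rewrite exprS -mulrA => /(irreducible_cancel iA hf (dhomogM (dhomogMn k hf) hg) nf); exact: IH.
Qed.

(* Restricting a linear relation to Z only leaves its terms with j = 0, so that these
   vanish; then divide by F. *)
Lemma linearly_free_shift W Z b m r k F l (G : 'I_r -> form) :
  integral_variety W -> irreducible Z -> Z `<=` W ->
  F \is b.-homog -> vanishes_on F Z -> ~ vanishes_on F W ->
  l \is 1.-homog -> ~ vanishes_on l Z ->
  (forall i, G i \is m.-homog) -> linearly_free Z G ->
  linearly_free W (fun p : 'I_k.+1 * 'I_r => F ^+ p.1 * l ^+ (b * (k - p.1)) * G p.2).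
Proof.
move=> [_ iW] iZ ZW hF FZ FW hl lZ hG frG.
(* With coefficients indexed by [nat], the induction on k can pass from [c] to its shift
   [fun j => c j.+1] after a division by F. *)
suff H (c : nat -> 'I_r -> K) :
    vanishes_on (\sum_(j < k.+1) F ^+ j * (l ^+ (b * (k - j)) * \sum_i c j i *: G i)) W ->
    forall j : 'I_k.+1, forall i, c j i = 0.
  move=> c Hc [j i]; have := H (fun j i => c (inord j, i)) _ j i; rewrite inord_val; apply.
  rewrite (_ : \sum_j _ = \sum_p c p *: (F ^+ p.1 * l ^+ (b * (k - p.1)) * G p.2)) //.
  transitivity (\sum_(j' < k.+1) \sum_(i' < r) c (j', i') *: (F ^+ j' * l ^+ (b * (k - j')) * G
    i')).
    apply: eq_bigr => j' _; rewrite mulrA mulr_sumr; apply: eq_bigr => i' _.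
    by rewrite inord_val scalerAr.
  by rewrite pair_bigA /=; apply: eq_bigr => -[].
have head_eq0 k' (c' : nat -> 'I_r -> K) :
    vanishes_on (\sum_(j < k'.+1) F ^+ j * (l ^+ (b * (k' - j)) * \sum_i c' j i *: G i)) W ->
    forall i, c' 0%N i = 0.
  rewrite big_ord_recl expr0 mul1r => Hc; apply: frG.
  have hs : \sum_i c' 0%N i *: G i \is m.-homog by apply: rpred_sum => i _; exact: rpredZ.
  apply: (irreducible_cancelX (k := (b * (k' - @ord0 k'))%N) iZ hl hs lZ).
  move=> v v0 Zv; have := Hc v v0 (ZW _ Zv); rewrite mevalD => /(canRL (addrK _)) E.
  apply: (etrans E); rewrite rmorph_sum big1 ?subrr // => j _.
  by rewrite lift0 exprS -mulrA [LHS]mevalM FZ // mul0r.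
elim: k c => [|k IH] c Hc; have c0 := head_eq0 _ _ Hc.
  by move=> j i; rewrite ord1; exact: c0.
rewrite big_ord_recl expr0 mul1r in Hc.
have {}IH := IH (fun j => c j.+1); have {}IH : forall j : 'I_k.+1, forall i, c j.+1 i = 0.
  apply: IH.
  have hS : \sum_(j < k.+1) F ^+ j * (l ^+ (b * (k - j)) * \sum_i c j.+1 i *: G i) \is (b * k +
    m).-homog.
    apply: rpred_sum => j _.
    have -> : (b * k + m = b * j + (1 * (b * (k - j)) + m))%N.
      by rewrite mul1n addnA -mulnDr subnKC // -ltnS.
    apply/dhomogM/dhomogM; first exact: dhomogMn.
      exact: dhomogMn.
    by apply: rpred_sum => i _; exact: rpredZ.
  apply: (irreducible_cancel iW hF hS FW).
  have -> : F * \sum_(j < k.+1) F ^+ j * (l ^+ (b * (k - j)) * \sum_i c j.+1 i *: G i) =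
    \sum_(i < k.+1) F ^+ lift ord0 i * (l ^+ (b * (k.+1 - lift ord0 i)) * \sum_i0 c (lift ord0
      i) i0 *: G i0).
    rewrite mulr_sumr; apply: eq_bigr => j _.
    by rewrite !lift0 subSS exprS -[RHS]mulrA.
  move: Hc; rewrite [X in _ * X + _]big1 ?mulr0 ?add0r // => i _.
  by rewrite c0 scale0r.
by move=> j i; case: (unliftP ord0 j) => [j' ->|-> //]; rewrite lift0 IH.
Qed.

Lemma coordinate_not_vanishing A : A !=set0 -> exists i, ~ vanishes_on ('X_i : form) A.
Proof.
case=> P; have [v v0 ->] := pt_surj P; move=> Av.
apply: contrapT => H; case/eqP: (v0); apply/rowP => i; rewrite !mxE.
apply: contrapT => vi; apply: H; exists i => /(_ v v0 Av); by rewrite mevalXU.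
Qed.

Lemma hom_X i : ('X_i : form) \is 1.-homog.
Proof. by rewrite dhomogX; apply/eqP/mdeg1. Qed.

(** A free family of r forms of degree m on Z gives (k + 1) r free forms of degree m + b k on W,
    where b is the degree of a form F vanishing on Z but not on W. Letting k grow like m gains one
    factor m + 1. *)
Lemma hilbert_growth_strict W Z d : integral_variety W -> integral_variety Z ->
  Z `<` W -> hilbert_growth W d ->
  exists2 d', d = d'.+1 & hilbert_growth Z d'.
Proof.
move=> iW [cZ iZ] [ZW nWZ] [C HC].
have [w [w0 Ww nZw]] := not_subset_ptP nWZ.
have [b [F [hF FZ Fw]]] := separation cZ w0 nZw.
have FW : ~ vanishes_on F W by move/(_ w w0 Ww) => E; rewrite E eqxx in Fw.
have [i0 lZ] := coordinate_not_vanishing iZ.1.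
have key m r (G : 'I_r -> form) k : (forall i, G i \is m.-homog) -> linearly_free Z G ->
    (k.+1 * r <= C * (m + b * k).+1 ^ d)%N.
  move=> hG frG; have := linearly_free_shift (k := k) iW iZ ZW hF FZ FW (hom_X i0) lZ hG frG.
  move/(hilbert_le_free (HC (m + b * k)%N)); rewrite card_prod !card_ord; apply => -[j i] /=.
  have -> : (m + b * k = b * j + 1 * (b * (k - j)) + m)%N.
    by rewrite mul1n -mulnDr subnKC 1?addnC // -ltnS.
  by apply: dhomogM => //; apply: dhomogM; apply: dhomogMn => //; exact: hom_X.
(* For d = 0 the Hilbert function of W is at most C, whereas the single form ['X_i0 ^+ C], free on
   Z, gives C + 1 free forms on W when k = C. *)
case: d HC key => [|d] HC key.
  have := key C 1%N (fun _ => 'X_i0 ^+ C) C; rewrite expn0 !muln1 ltnn => H; exfalso.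
  apply: notF; apply: H => [_|c]; first by rewrite -[C in C.-homog]mul1n; apply: dhomogMn;
    exact: hom_X.
  rewrite big_ord1 => Hc i; rewrite ord1; apply: contrapT => /eqP c0.
  have : vanishes_on ('X_i0 ^+ C * 1) Z.
    by move=> v v0 Zv; rewrite mulr1; have /eqP := Hc v v0 Zv;
      rewrite mevalZ mulf_eq0 (negPf c0) => /eqP.
  move/(irreducible_cancelX iZ (hom_X i0) (dhomog1 _ _) lZ).
  have [P ZP] := iZ.1; have [v v0 EP] := pt_surj P; rewrite EP in ZP.
  by move/(_ v v0 ZP)/eqP; rewrite rmorph1 oner_eq0.
(* Take k = m: then (m + 1) r <= C (m + b m + 1)^(d + 1) <= C (b + 1)^(d + 1) (m + 1)^(d + 1), and m
   + 1 cancels. *)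
exists d => //; exists (C * b.+1 ^ d.+1)%N => m; apply: free_hilbert_le => r G hG frG.
have := key m r G m hG frG.
have H : ((m + b * m).+1 <= b.+1 * m.+1)%N by lia.
move/leq_trans => /(_ (C * (b.+1 * m.+1) ^ d.+1)%N).
have Hd : (C * (m + b * m).+1 ^ d.+1 <= C * (b.+1 * m.+1) ^ d.+1)%N by apply: leq_mul;
  rewrite ?leq_exp2r.
move=> /(_ Hd).
rewrite expnMn (expnS m.+1) => H'; rewrite -(leq_pmul2l (ltn0Sn m)); apply: leq_trans H' _.
by rewrite -!mulnA [leqRHS]mulnCA [in leqRHS](mulnCA m.+1).
Qed.

(** Each step down the chain lowers the growth order by one. *)
Lemma chain_growth X d e Z : hilbert_growth X d -> chain X e Z -> (e <= d)%N.
Proof.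
move=> [C HC] [iZ sZ ZX].
have : hilbert_growth (Z e) d by exists C => m; exact: hilbert_le_sub (HC m).
elim: e d iZ sZ {ZX HC} => [//|e IH] d iZ sZ gZ.
have [d' -> gZ'] := hilbert_growth_strict (iZ e.+1 (leqnn _)) (iZ e (leqnSn _)) (sZ e (leqnn _))
  gZ.
by rewrite ltnS; apply: IH gZ' => i ie; [exact/iZ/leqW | exact/sZ/leqW].
Qed.

End Hilbert.

(** * Expansion along a direction, and Hilbert functions along fibers *)

Section Expansion.
Variables (K : fieldType) (n : nat).
Local Notation V := 'rV[K]_n.+1.
Local Notation form := {mpoly K[n.+1]}.
Implicit Types (f g : form) (p u v w : V) (A B : set (projspace K n)).

(** Taylor expansion of f in the direction p. The coefficient of t^d is the constant f(p), so the
    expansion is monic in t when f(p) = 1. *)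
Lemma homog_expand p d f : f \is d.-homog -> exists G : nat -> form,
  [/\ forall j, (j <= d)%N -> G j \is (d - j).-homog,
      forall j, (d < j)%N -> G j = 0, G d = (f.@[p 0])%:MP &
      forall w t, f.@[(w + t *: p) 0] = \sum_(j < d.+1) t ^+ j * (G j).@[w 0]].
Proof.
move: d f; apply: homog_ind => [|d|d c f g _ _ [F [hF F0 Fd EF]] [G [hG G0 Gd EG]]|d f i _ [F
  [hF F0 Fd EF]]].
- exists (fun j => if j == 0%N then 1 else 0); split=> [j|[]//||w t] //=.
  + by rewrite leqn0 => /eqP ->; rewrite dhomog1.
  + by rewrite rmorph1.
  + by rewrite big_ord1 expr0 mul1r !rmorph1.
- exists (fun=> 0); split=> // [j _||w t]; rewrite ?rpred0 ?meval0 ?mpolyC0 //.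
  by rewrite big1 // => j _; rewrite mulr0.
- exists (fun j => c *: F j + G j); split=> [j jd|j jd||w t].
  + by rewrite rpredD ?rpredZ ?hF ?hG.
  + by rewrite F0 // G0 // scaler0 addr0.
  + by rewrite Fd Gd mevalD mevalZ mpolyCD mpolyCM mul_mpolyC.
  + rewrite mevalD mevalZ EF EG mulr_sumr -big_split; apply: eq_bigr => j _ /=.
    by rewrite mevalD mevalZ mulrDr mulrCA.
- exists (fun j => 'X_i * F j + p 0 i *: (if j is j'.+1 then F j' else 0));
  split=> [j jd|j jd||w t].
  + apply: rpredD.
      case: (leqP j d) => [jd'|dj]; last by rewrite F0 // mulr0 rpred0.
      rewrite subSn // -[(d - j).+1]/(1 + (d - j))%N.
      by apply: dhomogM (hom_X _ _) (hF _ _).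
    by apply: rpredZ; case: j jd => [_|j jd]; [exact: rpred0 | rewrite subSS hF].
  + by rewrite F0 ?(ltnW jd) // mulr0; case: j jd => // j jd; rewrite F0 // scaler0 addr0.
  + by rewrite F0 // mulr0 add0r Fd mevalM mevalXU mpolyCM mul_mpolyC.
  + rewrite mevalM EF mevalXU !mxE mulrDl.
    have -> : \sum_(j < d.+2) t ^+ j * ('X_i * F j + p 0 i *: (if val j is j'.+1 then F j' else
      0)).@[w 0]
       = \sum_(j < d.+2) t ^+ j * (w 0 i * (F j).@[w 0]) +
         \sum_(j < d.+2) t ^+ j * (p 0 i * (if val j is j'.+1 then F j' else 0).@[w 0]).
      rewrite -big_split; apply: eq_bigr => j _ /=.
      by rewrite mevalD mevalZ mevalM mevalXU mulrDr.
    congr (_ + _).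
      rewrite [LHS]mulr_sumr [RHS]big_ord_recr /= (F0 d.+1 (ltnSn d)) meval0 !mulr0 addr0.
      by apply: eq_bigr => j _; rewrite mulrCA.
    rewrite [RHS]big_ord_recl /= meval0 !mulr0 add0r.
    rewrite mulr_sumr.
    by apply: eq_bigr => j _; rewrite /bump /= add1n exprS mulrACA.
Qed.

Lemma vanishes_on_eval0 d g B : B !=set0 -> g \is d.-homog -> vanishes_on g B ->
  g.@[(0 : V) 0] = 0.
Proof.
case=> P; have [v v0 ->] := pt_surj P; move=> Bv hg gB.
case: d hg => [|d] hg; last exact: homog_eval0 hg _.
by rewrite -(gB v v0 Bv); exact: homog0_const.
Qed.

(** On A, a form of degree m is determined by b forms on the image B, each taken in a space of
    dimension at most N. This serves for coordinate subspaces, with b = m + 1, and for projections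
    from a point outside A, with b the degree of an equation of A. The case [v *m M = 0] is that of
    the center of projection. *)
Lemma hilbert_le_fiber A B m N b i (M : 'M[K]_n.+1) : B !=set0 ->
  (forall v, v != 0 -> A (pt v) -> v *m M = 0 \/ v *m M != 0 /\ B (pt (v *m M))) ->
  (forall f, f \is m.-homog -> exists G : nat -> form,
     [/\ forall j, (j <= m)%N -> G j \is (m - j).-homog,
         forall j, (m < j)%N -> G j = 0 &
         forall v, v != 0 -> A (pt v) -> f.@[v 0] = \sum_(j < b) v 0 i ^+ j * (G j).@[(v *m M)
           0]]) ->
  (forall m', (m' <= m)%N -> hilbert_le B m' N) -> hilbert_le A m (b * N).
Proof.
move=> B0 MA HG HB.
have /choice[T HT] (j : 'I_b) : exists T : {I : finType & I -> form},
    [/\ (#|projT1 T| <= N)%N, forall k, projT2 T k \is (m - j).-homog &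
     forall f, f \is (m - j).-homog -> exists c : projT1 T -> K,
       vanishes_on (f - \sum_k c k *: projT2 T k) B].
  by have [I [s Hs]] := HB (m - j)%N (leq_subr _ _); exists (existT _ I s).
have /choice[s Hs] (q : {j : 'I_b & projT1 (T j)}) : exists s : form, s \is m.-homog /\
    forall v, s.@[v 0] = if (tag q <= m)%N then
      v 0 i ^+ tag q * (projT2 (T (tag q)) (tagged q)).@[(v *m M) 0] else 0.
  case: leqP => qm; last by exists 0; split=> [|v]; rewrite ?rpred0 ?meval0.
  have [_ /(_ (tagged q)) hq _] := HT (tag q).
  have [g hg Eg] := homog_mulmx M hq.
  exists ('X_i ^+ tag q * g); split=> [|v]; last by rewrite mevalM rmorphXn /= mevalXU Eg.
  rewrite -[m in m.-homog](subnKC qm) -[X in (X + _)%N]mul1n; apply: dhomogM hg.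
  by apply: dhomogMn; exact: hom_X.
exists {j : 'I_b & projT1 (T j)}, s; split=> [|q|f hf].
- rewrite card_tagged sumnE big_map big_enum /=.
  rewrite -[b in (b * N)%N](card_ord b) -sum_nat_const; apply: leq_sum => j _.
  by have [] := HT j.
- exact: (Hs q).1.
have [G [hG G0 EG]] := HG f hf.
have HC (j : 'I_b) : exists c : projT1 (T j) -> K, (j <= m)%N ->
    forall v, v = 0 \/ v != 0 /\ B (pt v) ->
    (G j).@[v 0] = \sum_k c k * (projT2 (T j) k).@[v 0].
  case: (leqP j m) => jm; last by exists (fun=> 0).
  have [_ hT /(_ _ (hG _ jm))[c Hc]] := HT j; exists c => _ v Bv.
  have E : (\sum_k c k *: projT2 (T j) k).@[v 0] = \sum_k c k * (projT2 (T j) k).@[v 0].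
    by rewrite rmorph_sum; apply: eq_bigr => k _ /=; rewrite mevalZ.
  rewrite -E; apply/eqP; rewrite -subr_eq0 -mevalB; apply/eqP.
  (* A relation that holds on B also holds at the zero vector, the image of the center. *)
  case: Bv => [->|[v0 Bv]]; last exact: Hc.
  apply: (vanishes_on_eval0 (d := (m - j)%N) B0 _ Hc); apply: rpredB; first exact: hG.
  by apply: rpred_sum => k _; apply: rpredZ; exact: hT.
pose c (q : {j : 'I_b & projT1 (T j)}) := projT1 (cid (HC (tag q))) (tagged q).
exists c => v v0 Av; rewrite mevalB EG // rmorph_sum /=; apply/eqP; rewrite subr_eq0; apply/eqP.
under [RHS]eq_bigr do rewrite mevalZ (Hs _).2.
rewrite -(sig_big_dep predT (fun _ => predT) (fun (j : 'I_b) (k : projT1 (T j)) =>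
  c (Tagged (fun j => projT1 (T j)) k) *
  (if (j <= m)%N then v 0 i ^+ j * (projT2 (T j) k).@[(v *m M) 0] else 0))) /=.
apply: eq_bigr => j _; case: leqP => jm; last first.
  by rewrite G0 // meval0 mulr0 big1 // => k _; rewrite mulr0.
rewrite (projT2 (cid (HC j)) jm _ (MA _ v0 Av)) mulr_sumr; apply: eq_bigr => k _.
by rewrite mulrCA.
Qed.

End Expansion.

(** * Coordinate subspaces *)

Section Subspaces.
Variables (K : fieldType) (n : nat).
Local Notation V := 'rV[K]_n.+1.
Local Notation form := {mpoly K[n.+1]}.
Implicit Types (f g : form) (p u v w : V) (A B W : set (projspace K n)).

Hypothesis Kclosed : forall p : {poly K}, size p != 1 -> exists x, root p x.

Lemma chain_append A W d Z : chain A d Z -> integral_variety W -> A `<` W ->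
  chain W d.+1 (fun i => if (i <= d)%N then Z i else W).
Proof.
move=> [iZ sZ ZA] iW [AW nWA]; split.
- by move=> i _; case: leqP => // id; exact: iZ.
- move=> i; rewrite ltnS => id; rewrite id; case: ltnP => id'; first exact: sZ.
  have -> : i = d by apply/eqP; rewrite eqn_leq id.
  by split=> [P /ZA /AW //|WZ]; apply: nWA => P /WZ /ZA.
- by rewrite ltnn.
Qed.

(** D collects the free coordinates, so the dimension is [#|D|] - 1, and the subspace is empty when
    D is. *)
Definition coord_subspace (D : {set 'I_n.+1}) : set (projspace K n) :=
  [set P | forall j, j \notin D -> hcoord P j = 0].

Lemma coord_subspace_pt D v : v != 0 ->
  coord_subspace D (pt v) <-> forall j, j \notin D -> v 0 j = 0.
Proof.
move=> v0; have [c c0 Ec] := hcoord_pt v0; split=> H j /H; last by rewrite Ec => ->;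
  rewrite mulr0.
by rewrite Ec => /eqP; rewrite mulf_eq0 (negPf c0) => /eqP.
Qed.

Lemma delta_coord_subspace (D : {set 'I_n.+1}) i : i \in D ->
  (delta_mx 0 i : V) != 0 /\ coord_subspace D (pt (delta_mx 0 i)).
Proof.
move=> iD; have d0 : (delta_mx 0 i : V) != 0.
  by apply/eqP => /rowP /(_ i) /eqP; rewrite !mxE !eqxx oner_eq0.
split=> //; apply/coord_subspace_pt => // j jD; rewrite mxE eqxx /=.
by case: eqP => // ji; rewrite ji iD in jD.
Qed.

Lemma closed_coord_subspace D : zariski_closed (coord_subspace D).
Proof.
apply: (closedP Kclosed (S := [set f | exists2 j, j \notin D & f = 'X_j])) => v v0.
rewrite coord_subspace_pt //; split=> [H f [j jD ->]|H j jD]; first by rewrite mevalXU H.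
by rewrite -mevalXU; apply: H; exists j.
Qed.

Lemma homog_line d f u w : f \is d.-homog ->
  exists q : {poly K}, q`_d = f.@[w 0] /\ forall t, q.[t] = f.@[(u + t *: w) 0].
Proof.
move=> /(homog_expand w)[G [_ _ Gd EG]]; exists (\poly_(j < d.+1) (G j).@[u 0]); split.
  by rewrite coef_poly ltnSn Gd mevalC.
by move=> t; rewrite horner_poly EG; apply: eq_bigr => j _; rewrite mulrC.
Qed.

(** If f(u) and g(w) are non-zero, then f and g restrict to non-zero polynomials in t on the line u
    + t w: the first has constant term f(u), the second has g(w) as its coefficient of t^e. Their
    product is non-zero at some t. *)
Lemma integral_coord_subspace (D : {set 'I_n.+1}) i : i \in D ->
  integral_variety (coord_subspace D).
Proof.
move=> iD; split; first exact: closed_coord_subspace.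
apply/irreducibleP; split.
  by exists (pt (delta_mx 0 i)); have [] := delta_coord_subspace iD.
move=> d e f g hf hg fg; apply: contrapT => /not_orP[].
move=> /not_vanishes_on[u [u0 Du fu]] /not_vanishes_on[w [w0 Dw gw]].
(* Degree 0 is set apart because a form f of positive degree vanishes at the zero vector; f(u + t w)
   != 0 then ensures that u + t w represents a point. *)
have [d0|d0] := posnP d.
  move/eqP: (fg w w0 Dw); rewrite mevalM mulf_eq0 (negPf gw) orbF.
  by rewrite d0 in hf; rewrite (homog0_const _ u hf) (negPf fu).
have [q [_ Eq]] := homog_line u w hf; have [r [re Er]] := homog_line u w hg.
have q0 : q != 0.
  by apply: contraNneq fu => q0; rewrite -[u]addr0 -(scale0r w) -Eq q0 horner0.
have r0 : r != 0 by apply: contraNneq gw => r0; rewrite -re r0 coef0.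
have [t] := ex_nonroot Kclosed (mulf_neq0 q0 r0).
rewrite hornerM Eq Er => H; case/eqP: (H); rewrite -mevalM; apply: fg.
  apply: contraNneq H => ->; by rewrite (homog_eval0 hf d0) mul0r.
have uw0 : u + t *: w != 0.
  by apply: contraNneq H => ->; rewrite (homog_eval0 hf d0) mul0r.
apply/(coord_subspace_pt _ uw0) => j jD; rewrite !mxE.
move/(coord_subspace_pt _ u0): Du => /(_ _ jD) ->.
by move/(coord_subspace_pt _ w0): Dw => /(_ _ jD) ->; rewrite mulr0 addr0.
Qed.

(** When [p 0 i = 1], this is the matrix of the linear projection along p onto the hyperplane x_i =
    0. *)
Definition away p i : 'M[K]_n.+1 := 1%:M - delta_mx i (0 : 'I_1) *m p.

Lemma mul_away p i v : v *m away p i = v - v 0 i *: p.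
Proof.
rewrite mulmxBr mulmx1 mulmxA; congr (_ - _).
by rewrite -colE [col i v]mx11_scalar mxE mul_scalar_mx.
Qed.

Lemma coord_subspace_proper (D : {set 'I_n.+1}) i : i \in D ->
  coord_subspace (D :\ i)%SET `<` coord_subspace D.
Proof.
move=> iD; split=> [P H j jD|H]; first by apply: H; rewrite finset.in_setD1 negb_and jD orbT.
have [d0 /H/(coord_subspace_pt _ d0) /(_ i)] := delta_coord_subspace iD.
by rewrite finset.in_setD1 eqxx => /(_ isT) /eqP; rewrite mxE !eqxx oner_eq0.
Qed.

Lemma card_gt0_ex (D : {set 'I_n.+1}) d : #|D| = d.+1 -> exists i, i \in D.
Proof. by move=> cD; apply/set0Pn; rewrite -cards_eq0 cD. Qed.

Lemma chain_coord_subspace (D : {set 'I_n.+1}) d : #|D| = d.+1 ->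
  exists Z, chain (coord_subspace D) d Z.
Proof.
elim: d D => [|d IH] D cD; have [i iD] := card_gt0_ex cD.
  by exists (fun=> coord_subspace D); split=> // _ _; exact: integral_coord_subspace iD.
have [|Z HZ] := IH (D :\ i)%SET; first by move: cD; rewrite (cardsD1 i) iD => -[].
eexists; apply: chain_append HZ (integral_coord_subspace iD) (coord_subspace_proper iD).
Qed.

Lemma hilbert_growth_coord_subspace (D : {set 'I_n.+1}) d : #|D| = d.+1 ->
  hilbert_growth (coord_subspace D) d.
Proof.
elim: d D => [|d IH] D cD; have [i iD] := card_gt0_ex cD.
  exists 1%N => m; rewrite mul1n expn0; exists unit, (fun=> 'X_i ^+ m); split=> [|_|f hf].
  - by rewrite card_unit.
  - by rewrite -[m in m.-homog]mul1n; apply: dhomogMn; exact: hom_X.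
  exists (fun=> f.@[(delta_mx 0 i : V) 0]) => v v0 /(coord_subspace_pt _ v0) Dv.
  rewrite (bigD1 tt) //= big1 ?addr0; last by case.
  have Ev : v = v 0 i *: delta_mx 0 i.
    apply/rowP => j; rewrite !mxE eqxx /=; case: eqP => [->|ji]; first by rewrite mulr1.
    rewrite mulr0 Dv //; apply/negP => jD.
    by have /eqP/cards1P[x Dx] := cD; move: iD jD ji;
      rewrite Dx !finset.in_set1 => /eqP -> /eqP ->.
  by rewrite mevalB mevalZ rmorphXn /= mevalXU {1}Ev (homog_evalZ _ _ hf) mulrC subrr.
have cD' : #|(D :\ i)%SET| = d.+1 by move: cD; rewrite (cardsD1 i) iD => -[].
have [k Hk] := IH _ cD'; have [j jD'] := card_gt0_ex cD'.
have [dj Dj] := delta_coord_subspace jD'.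
(* A form of degree m is a polynomial in x_i with m + 1 coefficients on the subspace where x_i = 0;
   this is the extra factor [m.+1]. *)
exists k => m; rewrite expnS mulnCA.
apply: (hilbert_le_fiber (B := coord_subspace (D :\ i)%SET) (i := i) (M := away (delta_mx 0 i)
  i)).
- by exists (pt (delta_mx 0 j)).
- move=> v v0 /(coord_subspace_pt _ v0) Dv; have [|w0] := eqVneq (v *m away (delta_mx 0 i) i) 0;
  [by left | right].
  split=> //; apply/coord_subspace_pt => // l;
    rewrite finset.in_setD1 negb_and negbK mul_away !mxE eqxx /=.
  by case: eqP => [->|_ /= /Dv ->]; rewrite ?mulr1 ?subrr // mulr0 subr0.
- move=> f /(homog_expand (delta_mx 0 i))[G [hG G0 _ EG]]; exists G; split=> // v v0 Dv.
  by rewrite mul_away -EG subrK.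
- move=> m' mm'; apply: hilbert_le_leq (Hk m').
  by rewrite leq_mul2l; case: (d) => [|e]; rewrite ?expn0 ?leq_exp2r ?ltnS ?mm' ?orbT.
Qed.

End Subspaces.

(** * Projection from a point *)

(** Since the leading coefficients survive, the sizes of p and q, and so the shape of the Sylvester
    matrix, are unchanged by phi. *)
Lemma resultant_map (R S : nzRingType) (phi : {rmorphism R -> S}) (p q : {poly R}) :
    phi (lead_coef p) != 0 -> phi (lead_coef q) != 0 ->
  phi (resultant p q) = resultant (map_poly phi p) (map_poly phi q).
Proof.
move=> hp hq; rewrite /resultant -det_map_mx /Sylvester_mx !size_map_poly_id0 //.
rewrite map_col_mx; congr (\det (col_mx _ _)); apply: map_lin1_mx => v /=;
  by rewrite map_poly_rV rmorphM /= map_rVpoly.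
Qed.

Lemma finite_roots (F : fieldType) (q : {poly F}) : q != 0 ->
  exists s : seq F, forall t, root q t -> t \in s.
Proof.
have [k] := ubnP (size q); elim: k q => // k IH q sq q0.
have [[x qx]|nr] := pselect (exists x, root q x); last first.
  by exists [::] => t qt; case: nr; exists t.
have /factor_theorem[r Er] := qx; have r0 : r != 0 by apply: contraNneq q0 => r0;
  rewrite Er r0 mul0r.
have [|s Hs] := IH r _ r0.
  by move: sq; rewrite Er size_Mmonic ?monicXsubC // size_XsubC addn2 /= ltnS.
by exists (x :: s) => t; rewrite Er rootM root_XsubC inE orbC => /orP[->|/Hs ->] //; rewrite orbT.
Qed.

Section PolyIdeal.
Variable F : fieldType.
Hypothesis Fclosed : forall p : {poly F}, size p != 1 -> exists x, root p x.

Lemma poly_eq_horner (q r : {poly F}) : (forall t, q.[t] = r.[t]) -> q = r.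
Proof.
move=> H; apply/eqP; rewrite -subr_eq0; apply: contraT => /(ex_nonroot Fclosed)[t].
by rewrite hornerD hornerN H subrr eqxx.
Qed.

(** A one-variable Nullstellensatz. Let u be a non-zero member of least size. If u had a root t,
    dividing a member that is non-zero at t by u would leave a smaller non-zero remainder in J. *)
Lemma poly_ideal_unit (J : {poly F} -> Prop) :
  (forall a u v, J u -> J v -> J (a * u + v)) ->
  (forall t, exists2 u, J u & u.[t] != 0) -> J 1.
Proof.
move=> JD Jt; pose Q k := `[< exists u, [/\ J u, u != 0 & size u = k] >].
have exQ : exists k, Q k.
  have [u Ju ut] := Jt 0; exists (size u); apply/asboolP; exists u; split=> //.
  by apply: contraNneq ut => ->; rewrite horner0.
have J0 : J 0.
  by have [u Ju _] := Jt 0; have := JD (-1) u u Ju Ju; rewrite mulN1r addNr.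
case: (ex_minnP exQ) => k /asboolP[u [Ju u0 su]] kmin.
have [/eqP|s1] := eqVneq (size u) 1%N.
  case/size_poly1P => c c0 Eu; have := JD (c^-1)%:P u 0 Ju J0.
  by rewrite Eu -polyCM mulVf // addr0.
have [t ut] := Fclosed s1; have [v Jv vt] := Jt t.
have Ev : v %% u = - (v %/ u) * u + v by rewrite {3}(divp_eq v u) mulNr addKr.
have : Q (size (v %% u)).
  apply/asboolP; exists (v %% u); split=> //; first by rewrite Ev; exact: JD.
  apply: contraNneq vt => r0; rewrite (divp_eq v u) r0 addr0 hornerM (rootP ut).
  by rewrite mulr0.
by move/kmin; rewrite -su leqNgt ltn_modp u0.
Qed.

End PolyIdeal.

Section Projection.
Variables (K : fieldType) (n : nat).
Local Notation V := 'rV[K]_n.+1.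
Local Notation form := {mpoly K[n.+1]}.
Implicit Types (f g h : form) (u v w : V) (A B W X Z : set (projspace K n)).

Hypothesis Kclosed : forall p : {poly K}, size p != 1 -> exists x, root p x.

Lemma closed_preimage (M : 'M[K]_n.+1) W : zariski_closed W ->
  exists2 B, zariski_closed B &
    forall v, v != 0 -> v *m M != 0 -> B (pt v) <-> W (pt (v *m M)).
Proof.
move=> cW; pose S := [set h : form | h \is homog mdeg /\ exists d f,
   [/\ f \is d.-homog, vanishes_on f W & forall v, h.@[v 0] = f.@[(v *m M) 0]]].
have hS h : S h -> h \is homog mdeg by case.
exists (zeros S) => [|v v0 vM0]; first by exists S.
rewrite zeros_pt //; split=> [H|Wv h [_ [d [f [_ fW ->]]]]]; last exact: fW.
apply: contrapT => /(separation cW vM0)[d [f [hf fW /eqP[]]]].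
have [h hh Eh] := homog_mulmx M hf; rewrite -Eh; apply: H; split; first exact: homogE hh.
by exists d, f.
Qed.

Variables (p : V) (i : 'I_n.+1).
Hypothesis pi1 : p 0 i = 1.

(* The image of Z under the projection from [p] to the hyperplane x_i = 0; it is only
   meaningful when [p] is not in Z. *)
Definition shadow Z : set (projspace K n) :=
  [set Q | exists v, [/\ v != 0, Z (pt v) & Q = pt (v *m away p i)]].

Lemma center_neq0 : p != 0.
Proof. by apply: contra_eq_neq pi1 => ->; rewrite mxE eq_sym oner_neq0. Qed.

Lemma away_neq0 Z v : ~ Z (pt p) -> v != 0 -> Z (pt v) -> v *m away p i != 0.
Proof.
move=> nZ v0 Zv; apply: contra_notN nZ; rewrite mul_away subr_eq0 => /eqP Ev.
suff -> : pt p = pt v by [].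
apply/esym/eq_pt; rewrite ?center_neq0 //; exists (v 0 i) => //.
by apply: contraNneq v0 => vi; rewrite Ev vi scale0r.
Qed.

Lemma line_neq0 w t : w != 0 -> w 0 i = 0 -> w + t *: p != 0.
Proof.
move=> w0 wi; apply: contraNneq (w0) => E.
have : (w + t *: p) 0 i = 0 by rewrite E mxE.
by rewrite !mxE wi pi1 mulr1 add0r => t0; move: E; rewrite t0 scale0r addr0 => ->.
Qed.

Lemma away_line w t : w 0 i = 0 -> (w + t *: p) *m away p i = w.
Proof. by move=> wi; rewrite mul_away !mxE wi pi1 mulr1 add0r addrK. Qed.

Lemma shadow_pt Z w : ~ Z (pt p) -> w != 0 ->
  shadow Z (pt w) <-> w 0 i = 0 /\ exists t, Z (pt (w + t *: p)).
Proof.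
move=> nZ w0; split=> [[v [v0 Zv]]|[wi [t Zt]]]; last first.
  by exists (w + t *: p); rewrite away_line //; split=> //; exact: line_neq0.
move/(eq_pt w0 (away_neq0 nZ v0 Zv)) => [c c0 Ew].
split; first by rewrite Ew mul_away !mxE pi1 mulr1 subrr mulr0.
exists (c * v 0 i); rewrite Ew mul_away scalerBr scalerA subrK pt_scale //.
Qed.

Lemma shadow_sub A B : A `<=` B -> shadow A `<=` shadow B.
Proof. by move=> AB Q [v [v0 /AB Bv ->]]; exists v. Qed.

(** An equation of X that is monic in the direction p. The factor ['X_i], equal to 1 at p, makes its
    degree positive. *)
Lemma monic_separation X : zariski_closed X -> ~ X (pt p) ->
  exists d f, [/\ (0 < d)%N, f \is d.-homog, vanishes_on f X & f.@[p 0] = 1].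
Proof.
move=> cX /(separation cX center_neq0)[d [f [hf fX fp]]].
exists (1 + d)%N, ((f.@[p 0])^-1 *: ('X_i * f)); split=> //.
- by apply/rpredZ/dhomogM => //; exact: hom_X.
- by move=> v v0 Xv; rewrite mevalZ mevalM (fX v) // !mulr0.
- by rewrite mevalZ mevalM mevalXU pi1 mul1r mulVf.
Qed.

(** Division by the monic equation f0: on X, the power d + 1 of x_i is a combination of lower
    powers, with coefficients that depend only on the projected point. *)
Lemma homog_reduce X d f0 : f0 \is d.+1.-homog -> vanishes_on f0 X -> f0.@[p 0] = 1 ->
  forall m f, f \is m.-homog -> exists G : nat -> form,
     [/\ forall j, (j <= m)%N -> G j \is (m - j).-homog,
         forall j, (m < j)%N -> G j = 0 &
         forall v, v != 0 -> X (pt v) ->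
           f.@[v 0] = \sum_(j < d.+1) v 0 i ^+ j * (G j).@[(v *m away p i) 0]].
Proof.
move=> hf0 f0X f0p; have [E [hE _ Ed EE]] := homog_expand p hf0.
have red v : v != 0 -> X (pt v) ->
    v 0 i ^+ d.+1 = - \sum_(j < d.+1) v 0 i ^+ j * (E j).@[(v *m away p i) 0].
  move=> v0 Xv; have := EE (v *m away p i) (v 0 i).
  rewrite {1}mul_away subrK f0X // big_ord_recr /= Ed f0p mevalC mulr1.
  by move/eqP; rewrite eq_sym addrC addr_eq0 => /eqP.
apply: homog_ind => [|m|m c f g _ _ [F [hF F0 EF]] [G [hG G0 EG]]|m f k _ [G [hG G0 EG]]].
- exists (fun j => if j == 0%N then 1 else 0); split=> [j|[]//|v v0 _] //=.
    by rewrite leqn0 => /eqP ->; rewrite dhomog1.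
  rewrite big_ord_recl /= expr0 mul1r !meval1 big1 ?addr0 // => j _.
  by rewrite meval0 mulr0.
- exists (fun=> 0); split=> // [j _|v v0 _]; first exact: rpred0.
  by rewrite meval0 big1 // => j _; rewrite /= meval0 mulr0.
- exists (fun j => c *: F j + G j); split=> [j jd|j jd|v v0 Xv].
  + by rewrite rpredD ?rpredZ ?hF ?hG.
  + by rewrite F0 // G0 // scaler0 addr0.
  + rewrite mevalD mevalZ EF // EG // mulr_sumr -big_split; apply: eq_bigr => j _ /=.
    by rewrite mevalD mevalZ mulrDr mulrCA.
(* With w the projection of v, [v 0 k = w 0 k + v 0 i * p 0 k]. The factor [v 0 i] shifts the
   coefficients by one, and the power d + 1 so created from [G d] is replaced through f0, whence the
   terms [G d * E j]. *)
exists (fun j => 'X_k * G j + p 0 k *: ((if j is j'.+1 then G j' else 0)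
         - (if (j <= d)%N then G d * E j else 0))).
split=> [j jm|j jm|v v0 Xv].
- apply: rpredD.
    case: (leqP j m) => [jm'|mj]; last by rewrite G0 // mulr0 rpred0.
    rewrite subSn // -[(m - j).+1]/(1 + (m - j))%N.
    by apply: dhomogM (hom_X _ _) (hG _ _).
  apply/rpredZ/rpredB.
    by case: j jm => [_|j jm]; [exact: rpred0 | rewrite subSS hG].
  case: leqP => jd; last exact: rpred0.
  have [dm|md] := leqP d m; last by rewrite G0 // mul0r rpred0.
  have -> : (m.+1 - j = (m - d) + (d.+1 - j))%N by lia.
  by apply: dhomogM; [exact: hG | apply: hE; exact: leqW].
- rewrite (G0 j (ltnW jm)) mulr0 add0r.
  have -> : (if (j <= d)%N then G d * E j else 0) = 0.
    by case: leqP => // jd; rewrite G0 ?mul0r //; lia.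
  by case: j jm => [//|j jm]; rewrite G0 // subr0 scaler0.
rewrite mevalM EG // mevalXU.
set w := v *m away p i; set S := \sum_(j < _) _.
have -> : v 0 k = w 0 k + v 0 i * p 0 k by rewrite /w mul_away !mxE subrK.
rewrite mulrDl.
transitivity (\sum_(j < d.+1) v 0 i ^+ j * (w 0 k * (G j).@[w 0]) +
  (\sum_(j < d.+1) v 0 i ^+ j * (p 0 k * (if val j is j'.+1 then G j' else 0).@[w 0]) -
   \sum_(j < d.+1) v 0 i ^+ j * (p 0 k * ((G d).@[w 0] * (E j).@[w 0])))); last first.
  rewrite -sumrB -big_split; apply: eq_bigr => j _ /=.
  have -> : (j <= d)%N by rewrite -ltnS.
  by rewrite mevalD mevalZ mevalB !mevalM mevalXU !mulrDr mulrN !mulrN.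
congr (_ + _); first by rewrite mulr_sumr; apply: eq_bigr => j _; rewrite mulrCA.
rewrite [X in _ = X - _]big_ord_recl /= meval0 !mulr0 add0r.
have -> : \sum_(j < d.+1) v 0 i ^+ j * (p 0 k * ((G d).@[w 0] * (E j).@[w 0]))
   = - (p 0 k * (G d).@[w 0] * v 0 i ^+ d.+1).
  rewrite red // mulrN opprK mulr_sumr; apply: eq_bigr => j _.
  by rewrite -/w (mulrA (p 0 k)) mulrCA.
rewrite opprK /S big_ord_recr /= mulrDr; congr (_ + _).
  rewrite mulr_sumr; apply: eq_bigr => j _.
  by rewrite /bump /= add1n exprS mulrACA.
by rewrite mulrACA -exprS mulrC.
Qed.

Lemma hilbert_growth_shadow X d : zariski_closed X -> ~ X (pt p) -> X !=set0 ->
  hilbert_growth (shadow X) d -> hilbert_growth X d.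
Proof.
move=> cX nX [P XP] [k Hk]; have [[|e] [f0 [e0 hf0 f0X f0p]]] := monic_separation cX nX => //.
exists (e.+1 * k)%N => m; rewrite -mulnA.
apply: (hilbert_le_fiber (B := shadow X) (i := i) (M := away p i)).
- by move: XP; have [v v0 ->] := pt_surj P => Xv; exists (pt (v *m away p i)), v.
- by move=> v v0 Xv; right; split; [exact: away_neq0 Xv | exists v].
- exact: homog_reduce hf0 f0X f0p m.
- move=> m' mm'; apply: hilbert_le_leq (Hk m').
  by rewrite leq_mul2l; case: (d) => [|?]; rewrite ?expn0 ?leq_exp2r ?ltnS ?mm' ?orbT.
Qed.

Lemma irreducible_shadow X : ~ X (pt p) -> irreducible X -> irreducible (shadow X).
Proof.
move=> nX /irreducibleP[[P XP] iX]; apply/irreducibleP; split.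
  by move: XP; have [v v0 ->] := pt_surj P => Xv; exists (pt (v *m away p i)), v.
have key e (h h' : form) : h' \is e.-homog ->
    (forall v, h'.@[v 0] = h.@[(v *m away p i) 0]) ->
    vanishes_on h (shadow X) <-> vanishes_on h' X.
  move=> hh' Eh; split=> H v v0 Xv; first by rewrite Eh; apply: H; [exact: away_neq0 Xv|exists v].
  have [vi [t Xt]] := (shadow_pt nX v0).1 Xv.
  by rewrite -(away_line t vi) -Eh H // line_neq0.
move=> d e f g hf hg; have [f' hf' Ef] := homog_mulmx (away p i) hf.
have [g' hg' Eg] := homog_mulmx (away p i) hg.
move/(key _ _ (f' * g') (dhomogM hf' hg')) => H.
have [|fX|gX] := iX _ _ _ _ hf' hg'.
- by apply: H => v; rewrite !mevalM Ef Eg.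
- by left; apply/(key _ _ _ hf' Ef).
- by right; apply/(key _ _ _ hg' Eg).
Qed.

End Projection.

(** * Closedness of projections, and lifting of chains *)

Section ClosedProjection.
Variables (K : fieldType) (n : nat).
Local Notation V := 'rV[K]_n.+1.
Local Notation form := {mpoly K[n.+1]}.
Implicit Types (f g h : form) (u v w : V) (A B W X Z : set (projspace K n)).

Hypothesis Kclosed : forall p : {poly K}, size p != 1 -> exists x, root p x.

Section Center.
Variables (p : V) (i : 'I_n.+1).
Hypothesis pi1 : p 0 i = 1.

Lemma homog_line_poly d f : f \is d.-homog -> f.@[p 0] = 1 ->
  exists F : {poly form}, [/\ F \is monic, size F = d.+1 &
    forall w t, (map_poly (meval (w 0)) F).[t] = f.@[(w + t *: p) 0]].
Proof.
move=> /(homog_expand p)[G [_ _ Gd EG]] fp.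
have sF : size (\poly_(j < d.+1) G j) = d.+1.
  by rewrite size_poly_eq // Gd fp mpolyC1 oner_eq0.
exists (\poly_(j < d.+1) G j); split=> // [|w t].
  by rewrite monicE lead_coefE sF coef_poly ltnSn Gd fp mpolyC1.
rewrite EG (@horner_coef_wide _ d.+1); last by rewrite (leq_trans (size_poly _ _)) ?sF.
by apply: eq_bigr => j _; rewrite coef_map coef_poly ltn_ord mulrC.
Qed.

(** The expansion along p of a polynomial that may mix degrees, obtained by adding those of its
    homogeneous components. *)
Lemma line_poly h : exists F : {poly form},
  forall w t, (map_poly (meval (w 0)) F).[t] = h.@[(w + t *: p) 0].
Proof.
have /choice[G HG] d : exists F : {poly form},
    forall w t, (map_poly (meval (w 0)) F).[t] = (pihomog mdeg d h).@[(w + t *: p) 0].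
  have [G [_ _ _ EG]] := homog_expand p (pihomogP _ d h).
  exists (\poly_(j < d.+1) G j) => w t.
  rewrite EG (@horner_coef_wide _ d.+1); last first.
    by rewrite (leq_trans (size_poly _ _)) ?size_poly.
  by apply: eq_bigr => j _; rewrite coef_map coef_poly ltn_ord mulrC.
exists (\sum_(d < msize h) G d) => w t.
rewrite [in RHS](pihomog_partitionE (mf := @mdeg n.+1 : measure _) (leqnn (msize h))).
by rewrite !rmorph_sum horner_sum; apply: eq_bigr => d _; exact: HG.
Qed.

(* The pullbacks to the line through w and p of the polynomials vanishing on Z form
   an ideal without common zero, hence some h is identically 1 on this line; its
   resultant with an equation of Z that is monic along p vanishes on the projection
   of Z, and does not vanish at w. *)
Lemma closed_shadow Z : zariski_closed Z -> ~ Z (pt p) -> zariski_closed (shadow p i Z).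
Proof.
move=> cZ nZ; apply: (closedP Kclosed (S := [set g | vanishes_on g (shadow p i Z)])) => w w0.
split=> [Zw g|H]; first by apply.
apply: contrapT => nw.
have wi : w 0 i = 0.
  have := H 'X_i; rewrite mevalXU; apply=> v v0 /(shadow_pt pi1 nZ v0)[vi _].
  by rewrite mevalXU.
have nline t : ~ Z (pt (w + t *: p)) by move=> Zt; apply/nw/(shadow_pt pi1 nZ w0); split;
  last exists t.
pose J (u : {poly K}) := exists2 h, vanishes_on h Z & forall t, u.[t] = h.@[(w + t *: p) 0].
have [h hZ hw] : J 1.
  apply: (poly_ideal_unit Kclosed).
    (* The i-th coordinate of w + t p is t, so a(t) is the restriction of a(x_i) to the line. *)
    move=> a u v [hu uZ Eu] [hv vZ Ev]; exists ((map_poly (@mpolyC _ K) a).['X_i] * hu + hv).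
      by apply: vanishes_onD => //; exact: vanishes_onMl.
    move=> t; rewrite mevalD mevalM -horner_map /= mevalXU -map_poly_comp.
    rewrite (_ : (w + t *: p) 0 i = t); last by rewrite !mxE wi pi1 mulr1 add0r.
    rewrite (_ : map_poly _ a = a) ?hornerD ?hornerM ?Eu ?Ev //.
    by apply/polyP => k; rewrite coef_map_id0 /= ?mevalC ?meval0.
  move=> t; have [d [f [hf fZ ft]]] := separation cZ (line_neq0 pi1 t w0 wi) (nline t).
  have [q [_ Eq]] := homog_line w p hf; exists q; last by rewrite Eq.
  by exists f.
have [d [f [d0 hf fZ fp]]] := monic_separation pi1 cZ nZ.
have [F [mF sF EF]] := homog_line_poly hf fp; have [H0 EH] := line_poly h.
(* Adding ['X^N * F] makes H1 monic, so that its resultant with F commutes with evaluation. H1 still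
   vanishes over Z, and at w it becomes ['X^N * q + 1], coprime to the value q of F. *)
pose N := size H0; pose H1 := H0 + 'X^N * F.
have sXF : size ('X^N * F) = (N + d.+1)%N.
  by rewrite size_Mmonic ?monic_neq0 ?monicXn ?polyXn_eq0 // size_polyXn sF addSn addnS.
have sH1 : size H1 = (N + d.+1)%N by rewrite /H1 addrC size_polyDl sXF // -addSnnS leq_addr.
have mH1 : H1 \is monic.
  by rewrite monicE /H1 addrC lead_coefDl ?sXF ?lead_coefM ?lead_coefXn ?mul1r -?monicE //
    -addSnnS leq_addr.
have [||[U T] _ ER] := @resultant_in_ideal _ F H1.
- by rewrite sF ltnS.
- by rewrite sH1 addnS ltnS addn_gt0 d0 orbT.
have RZ : vanishes_on (resultant F H1) (shadow p i Z).
  move=> v v0 /(shadow_pt pi1 nZ v0)[vi [t Zt]].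
  have vt0 := line_neq0 pi1 t v0 vi.
  have := congr1 (fun P : {poly form} => (map_poly (meval (v 0)) P).[t]) ER.
  rewrite /= map_polyC hornerC => ->; rewrite rmorphD !rmorphM hornerD !hornerM EF fZ //.
  by rewrite /H1 rmorphD rmorphM hornerD hornerM EH EF hZ // fZ // !(mulr0, addr0).
have /eqP := H _ RZ; apply/negP.
rewrite resultant_map ?(monicP mF) ?(monicP mH1) ?rmorph1 ?oner_eq0 //.
have -> : map_poly (meval (w 0)) H1 = 'X^N * map_poly (meval (w 0)) F + 1.
  rewrite /H1 rmorphD rmorphM /= map_polyXn addrC; congr (_ + _).
  by apply: (poly_eq_horner Kclosed) => t; rewrite EH hw.
rewrite resultant_eq0 -leqNgt; set q := map_poly _ _.
have : coprimep q ('X^N * q + 1) by rewrite coprimep_addl_mul coprimep1.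
by rewrite coprimep_def => /eqP ->.
Qed.

(* The fibers of the projection are finite, so that Zorn's lemma gives a minimal closed
   subset of Z whose image contains W, and minimality makes it irreducible. *)
Lemma lift_shadow Z W : zariski_closed Z -> ~ Z (pt p) -> integral_variety W ->
  W `<=` shadow p i Z ->
  exists Y, [/\ integral_variety Y, Y `<=` Z & shadow p i Y = W].
Proof.
move=> cZ nZ [cW iW] WZ.
have [B cB EB] := closed_preimage (away p i) cW; pose Z0 := Z `&` B.
have cZ0 : zariski_closed Z0 by exact: closedI.
have [d [f [d0 hf fZ fp]]] := monic_separation pi1 cZ nZ.
(* Zorn's lemma is applied to the removed part U: a maximal U leaves a minimal closed set. Z0 only
   keeps the points of Z lying over W, so no image exceeds W. *)
pose P U := zariski_closed (Z0 `\` U) /\ W `<=` shadow p i (Z0 `\` U).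
have nZU U : ~ (Z0 `\` U) (pt p) by move=> [[]].
have PT : P set0.
  rewrite /P setD0; split=> //; apply: subset_ptP => w w0 Ww.
  have [wi [t Zt]] := (shadow_pt pi1 nZ w0).1 (WZ _ Ww).
  apply/(shadow_pt pi1 _ w0); first by case.
  split=> //; exists t; split=> //.
  by apply/(EB _ (line_neq0 pi1 t w0 wi)); rewrite away_line.
have [|U [[cU WU] Umax]] := @Zorn_bigcup _ P.
  move=> F FP Ftot; split.
    have -> : Z0 `\` \bigcup_(X in F) X = Z0 `&` \bigcap_(X in F) (Z0 `\` X).
      apply/seteqP; split=> [Q [ZQ nQ]|Q [ZQ HQ]]; split=> //.
        by move=> X FX; split=> // XQ; apply: nQ; exists X.
      by move=> [X FX XQ]; have [] := HQ X FX.
    by apply: (closedI Kclosed) => //; apply: (closed_bigcap Kclosed) => X /FP[].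
  apply: subset_ptP => w w0 Ww.
  have [wi _] := (shadow_pt pi1 nZ w0).1 (WZ _ Ww).
  apply/(shadow_pt pi1 (nZU _) w0); split=> //.
  (* The points of Z over w correspond to roots of q, which has leading coefficient f(p) = 1. If the
     union removed all these finitely many points, a single member of the chain would already do
     so. *)
  have [q [qd Eq]] := homog_line w p hf.
  have q0 : q != 0 by apply: contra_eq_neq fp => q0; rewrite -qd q0 coef0 eq_sym oner_eq0.
  have [s Hs] := finite_roots q0.
  apply: contrapT => nt.
  suff [X [PX HX]] : exists X, P X /\ forall t, t \in s -> Z0 (pt (w + t *: p)) -> X (pt (w + t
    *: p)).
    have [_ [t [Zt nXt]]] := (shadow_pt pi1 (nZU _) w0).1 (PX.2 _ Ww).
    apply/nXt/HX => //; apply: Hs; apply/rootP; rewrite Eq fZ //; first exact: (line_neq0 pi1).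
    by case: Zt.
  (* The alternative [set0] starts the induction on s, and covers an empty family F. *)
  suff [X [_ [PX HX]]] : exists X, (X = set0 \/ F X) /\ P X /\
      forall t, t \in s -> Z0 (pt (w + t *: p)) -> X (pt (w + t *: p)) by exists X.
  elim: s {Hs} => [|t s [X [FX [PX HX]]]]; first by exists set0; split; [left|].
  have [Zt|nZt] := pselect (Z0 (pt (w + t *: p))); last first.
    by exists X; split=> //; split=> // t'; rewrite inE => /orP[/eqP ->|/HX].
  have [X' FX' Xt'] : exists2 X', F X' & X' (pt (w + t *: p)).
    by apply: contrapT => nX'; apply: nt; exists t; split=> // -[X' FX' Xt]; apply: nX';
      exists X'.
  have [XX'|X'X] : X `<=` X' \/ X' `<=` X.
    by case: FX => [->|FX]; [left; exact: sub0set | exact: Ftot].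
  - exists X'; split; first by right.
    split; first exact: FP.
    by move=> t'; rewrite inE => /orP[/eqP ->|/HX H /H /XX'].
  - exists X; split=> //; split=> // t'; rewrite inE => /orP[/eqP -> _|/HX //].
    exact: X'X.
exists (Z0 `\` U); split; last 2 first.
- by move=> Q [[]].
- apply/seteqP; split=> // Q [v [v0 [[Zv Bv] _] ->]].
  exact: ((EB _ v0 (away_neq0 pi1 nZ v0 Zv)).1 Bv).
split=> //; split.
  by have [Q /WU [v [v0 Zv _]]] := iW.1; exists (pt v).
(* Otherwise the complement of C could be removed too, against the maximality of U. *)
have half C : zariski_closed C -> W `<=` shadow p i ((Z0 `\` U) `&` C) -> Z0 `\` U `<=` C.
  move=> cC WC Q [ZQ nUQ]; apply: contrapT => nCQ.
  apply: (Umax (U `|` ~` C)).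
    split; first by left.
    by move=> /(_ Q) H; apply/nUQ/H; right.
  have E : Z0 `\` (U `|` ~` C) = (Z0 `\` U) `&` C.
    by rewrite setDUr !setDE setCK; rewrite setIACA setIid setIA.
  by rewrite /P E; split=> //; exact: closedI.
move=> C D cC cD CD.
have cS E : zariski_closed E -> zariski_closed (shadow p i ((Z0 `\` U) `&` E)).
  by move=> cE; apply: closed_shadow; [exact: closedI | case=> -[[]]].
have [|H|H] := iW.2 _ _ (cS _ cC) (cS _ cD); last 2 first.
- by left; exact: half.
- by right; exact: half.
move=> Q /WU[v [v0 Zv ->]].
by case: (CD _ Zv) => [Cv|Dv]; [left|right]; exists v.
Qed.

(** The top member is lifted first and the others are then lifted inside it; the inclusions are
    strict because those of the images are. *)
Lemma chain_shadow d (C : nat -> set (projspace K n)) Z : zariski_closed Z -> ~ Z (pt p) ->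
  chain (shadow p i Z) d C ->
  exists2 Y, chain Z d Y & shadow p i (Y d) = C d.
Proof.
elim: d Z => [|d IH] Z cZ nZ [iC sC CZ]; have [Y' [iY Y'Z EY]] := lift_shadow cZ nZ (iC _ (leqnn
  _)) CZ.
  by exists (fun=> Y').
have [||Y cY EYd] := IH Y' iY.1; first by move/Y'Z.
  by split=> [j jd|j jd|]; [exact/iC/leqW | exact/sC/leqW | rewrite EY;
    exact: (sC d (leqnn _)).1].
exists (fun j => if (j <= d)%N then Y j else Y'); last by rewrite ltnn.
have [iYj sYj YY'] := cY.
have [_ s2 Ztop] : chain Y' d.+1 (fun j => if (j <= d)%N then Y j else Y').
  apply: (chain_append (A := Y d)) => //; split=> // Y'Y.
  by apply: (sC d (leqnn _)).2; rewrite -EYd -EY; exact: shadow_sub.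
split=> // [j jd|]; last by rewrite ltnn.
by case: leqP => // jd'; exact: iYj.
Qed.

End Center.

(** Induction on the number of coordinates of a coordinate subspace containing X. Unless X fills it,
    X is projected from a point p of the subspace outside X, with [p 0 i = 1]; the image lies in the
    subspace without the coordinate i, and both the chain and the growth order are carried back to
    X. *)
Lemma chain_hilbert_growth X : integral_variety X ->
  exists d, (exists C : nat -> _, chain X d C) /\ hilbert_growth X d.
Proof.
suff H k (D : {set 'I_n.+1}) : #|D| = k -> forall X, integral_variety X ->
    X `<=` coord_subspace D -> exists d, (exists C : nat -> _, chain X d C) /\ hilbert_growth X d.
  move=> iX; apply: (H _ finset.setT erefl _ iX) => P _ j.
  by rewrite finset.in_setT.
elim: k D => [|k IH] D cD {}X [cX iX] XD.
  have [P] := iX.1; have [v v0 ->] := pt_surj P; move=> Xv.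
  case/eqP: (v0); apply/rowP => j; rewrite mxE.
  by have /(coord_subspace_pt _ v0) := XD _ Xv; apply; rewrite (cards0_eq cD) finset.in_set0.
have [DX|] := pselect (coord_subspace D `<=` X).
  have -> : X = coord_subspace D by apply/seteqP.
  by exists k; split; [exact: chain_coord_subspace | exact: hilbert_growth_coord_subspace].
move=> /not_subset_ptP[p' [p'0 Dp' nXp']].
have [i pi0] : exists i, p' 0 i != 0.
  apply: contrapT => H; case/eqP: p'0; apply/rowP => j; rewrite mxE.
  by apply: contrapT => /eqP pj; apply: H; exists j.
pose p := (p' 0 i)^-1 *: p'.
have pi1 : p 0 i = 1 by rewrite mxE mulVf.
have nX : ~ X (pt p) by rewrite pt_scale ?invr_neq0.
have iD : i \in D.
  apply: contraNT pi0 => iD; apply/eqP.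
  by have /(coord_subspace_pt _ p'0) := Dp'; exact.
have cD' : #|(D :\ i)%SET| = k by move: cD; rewrite (cardsD1 i) iD => -[].
have iS : integral_variety (shadow p i X).
  by split; [exact: closed_shadow | exact: irreducible_shadow].
have [|d [[Z cZ] gX]] := IH _ cD' _ iS.
  apply: subset_ptP => w w0 /(shadow_pt pi1 nX w0)[wi [t Xt]].
  have wt0 := line_neq0 pi1 t w0 wi.
  apply/(coord_subspace_pt _ w0) => j; rewrite finset.in_setD1 negb_and negbK =>
    /orP[/eqP -> //|jD].
  have /(coord_subspace_pt _ wt0)/(_ j jD) := XD _ Xt.
  rewrite !mxE; have /(coord_subspace_pt _ p'0)/(_ j jD) -> := Dp'.
  by rewrite !mulr0 addr0.
exists d; split; last exact: hilbert_growth_shadow nX iX.1 gX.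
by have [Y cY _] := chain_shadow pi1 cX nX cZ; exists Y.
Qed.

End ClosedProjection.

(** * Torus action and Hadamard products *)

Section Torus.
Variables (K : fieldType) (n : nat).
Local Notation V := 'rV[K]_n.+1.
Local Notation form := {mpoly K[n.+1]}.
Implicit Types (f g : form) (h q u v w : V) (A B X Y : set (projspace K n)).

Hypothesis Kclosed : forall p : {poly K}, size p != 1 -> exists x, root p x.

Definition mulv h v : V := \row_k (h 0 k * v 0 k).
Definition invv h : V := \row_k (h 0 k)^-1.
Definition full_support h := forall k, h 0 k != 0.

Lemma mulv_diag h v : mulv h v = v *m diag_mx h.
Proof. by apply/rowP => k; rewrite mul_mx_diag !mxE mulrC. Qed.

Lemma mulvC u v : mulv u v = mulv v u.
Proof. by apply/rowP => k; rewrite !mxE mulrC. Qed.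

Lemma mulvA u v w : mulv u (mulv v w) = mulv (mulv u v) w.
Proof. by apply/rowP => k; rewrite !mxE mulrA. Qed.

Lemma mulvZ h c v : mulv h (c *: v) = c *: mulv h v.
Proof. by apply/rowP => k; rewrite !mxE mulrCA. Qed.

Lemma mulKv h v : full_support h -> mulv (invv h) (mulv h v) = v.
Proof. by move=> H; apply/rowP => k; rewrite !mxE mulKf. Qed.

Lemma mulVKv h v : full_support h -> mulv h (mulv (invv h) v) = v.
Proof. by move=> H; apply/rowP => k; rewrite !mxE mulVKf. Qed.

Lemma full_support_inv h : full_support h -> full_support (invv h).
Proof. by move=> H k; rewrite mxE invr_eq0. Qed.

Lemma full_support_neq0 h : full_support h -> h != 0.
Proof. by move=> H; apply: contraNneq (H 0) => ->; rewrite mxE. Qed.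

Lemma mulv_neq0 h v : full_support h -> v != 0 -> mulv h v != 0.
Proof.
move=> H; apply: contraNneq => E; rewrite -(mulKv v H) E.
by apply/eqP/rowP => k; rewrite !mxE mulr0.
Qed.

Lemma homog_mulv d f h : f \is d.-homog ->
  exists2 g, g \is d.-homog & forall v, g.@[v 0] = f.@[(mulv h v) 0].
Proof.
by move=> /(homog_mulmx (diag_mx h))[g hg Eg]; exists g => // v; rewrite Eg mulv_diag.
Qed.

Lemma mevalX_mulv (a : 'X_{1..n.+1}) h v :
  ('X_[a] : form).@[(mulv h v) 0] = 'X_[a].@[h 0] * 'X_[a].@[v 0].
Proof. by rewrite !mevalX -big_split; apply: eq_bigr => k _; rewrite mxE exprMn. Qed.

Lemma mevalX_neq0 (a : 'X_{1..n.+1}) h : full_support h -> ('X_[a] : form).@[h 0] != 0.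
Proof. by move=> H; rewrite mevalX; apply/prodf_neq0 => k _; rewrite expf_neq0. Qed.

Lemma mevalX_inv (a : 'X_{1..n.+1}) h : ('X_[a] : form).@[(invv h) 0] = ('X_[a].@[h 0])^-1.
Proof. by rewrite !mevalX -prodfV; apply: eq_bigr => k _; rewrite mxE exprVn. Qed.

Lemma ex_full_support A : ~ (A `<=` coord_hyperplanes K n) ->
  exists2 v, full_support v & A (pt v).
Proof.
move=> nA; have [P [AP nP]] : exists P, A P /\ ~ coord_hyperplanes K n P.
  by apply: contrapT => H; apply: nA => P AP; apply: contrapT => nP; apply: H; exists P.
exists (val (repr P)); last by rewrite pt_repr.
by move=> k; apply/eqP => Pk; apply: nP; exists k.
Qed.

Definition translate h A : set (projspace K n) :=
  [set Q | exists v, [/\ v != 0, A (pt v) & Q = pt (mulv h v)]].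

Lemma translate_pt h A w : full_support h -> w != 0 ->
  translate h A (pt w) <-> A (pt (mulv (invv h) w)).
Proof.
move=> H w0; split=> [[v [v0 Av]]|Aw]; last first.
  by exists (mulv (invv h) w); rewrite mulVKv // mulv_neq0 //; exact: full_support_inv.
move/(eq_pt w0 (mulv_neq0 H v0)) => [c c0 ->].
by rewrite mulvZ mulKv // pt_scale.
Qed.

Lemma translate_sub h A B : A `<=` B -> translate h A `<=` translate h B.
Proof. by move=> AB Q [v [v0 /AB Bv ->]]; exists v. Qed.

Lemma translate_proper h A B : full_support h -> A `<` B -> translate h A `<` translate h B.
Proof.
move=> H [AB nBA]; split; first exact: translate_sub.
move=> BA; apply: nBA; apply: subset_ptP => v v0 Bv.
have hv0 := mulv_neq0 H v0.
have /BA/(translate_pt _ H hv0) : translate h B (pt (mulv h v)) by exists v.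
by rewrite mulKv.
Qed.

Lemma integral_translate h A : full_support h -> integral_variety A ->
  integral_variety (translate h A).
Proof.
move=> H [cA /irreducibleP[[P AP] iA]]; split.
  have [B cB EB] := closed_preimage (diag_mx (invv h)) cA.
  suff -> : translate h A = B by [].
  apply: set_ptP => w w0; rewrite translate_pt // EB // -mulv_diag //.
  exact/mulv_neq0/w0/full_support_inv.
apply/irreducibleP; split.
  by move: AP; have [v v0 ->] := pt_surj P => Av; exists (pt (mulv h v)), v.
have key (f f' : form) : (forall v, f'.@[v 0] = f.@[(mulv h v) 0]) ->
    vanishes_on f (translate h A) <-> vanishes_on f' A.
  move=> Ef; split=> fA v v0 Av; first by rewrite Ef; apply: fA; [exact: mulv_neq0|exists v].
  rewrite -(mulVKv v H) -Ef; apply: fA; last by apply/translate_pt.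
  exact/mulv_neq0/v0/full_support_inv.
move=> d e f g hf hg; have [f' hf' Ef] := homog_mulv h hf.
have [g' hg' Eg] := homog_mulv h hg.
move/(key _ (f' * g')) => E.
have [|fX|gX] := iA _ _ _ _ hf' hg'.
- by apply: E => v; rewrite !mevalM Ef Eg.
- by left; apply/(key _ _ Ef).
- by right; apply/(key _ _ Eg).
Qed.

Lemma chain_translate h A d (C : nat -> set (projspace K n)) : full_support h ->
  chain A d C -> chain (translate h A) d (fun k => translate h (C k)).
Proof.
move=> H [iC sC CA]; split=> [k kd|k kd|]; last exact: translate_sub.
  exact/integral_translate/iC.
exact/translate_proper/sC.
Qed.

(* Any form vanishing on X can be shortened using h in the stabilizer of X, unless all
   its monomials take the same value at h. *)
Lemma stabilizer_character X m f x : full_support x -> X (pt x) ->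
  f \is m.-homog -> f != 0 -> vanishes_on f X ->
  exists a b : 'X_{1..n.+1}, [/\ a != b, mdeg a = m, mdeg b = m &
    forall h, full_support h -> (forall v, v != 0 -> X (pt v) -> X (pt (mulv h v))) ->
      ('X_[a] : form).@[h 0] = 'X_[b].@[h 0]].
Proof.
move=> x0 Xx; have [k] := ubnP (size (msupp f)); elim: k f => // k IH f sf hf f0 fX.
have us := msupp_uniq f.
have hm a : a \in msupp f -> mdeg a = m by move/dhomogP: hf; exact.
have ca a : a \in msupp f -> f@_a != 0 by rewrite mcoeff_msupp.
(* A single monomial could not vanish at x, all of whose coordinates are non-zero. *)
have [a [b [ma mb ab]]] : exists a b, [/\ a \in msupp f, b \in msupp f & a != b].
  case E : (msupp f) us => [|a [|b s]] us.
  - by move/eqP: E; rewrite msupp_eq0 (negPf f0).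
  - have := fX x (full_support_neq0 x0) Xx; rewrite [f]mpolyE E big_seq1 mevalZ => /eqP.
    rewrite mulf_eq0 (negPf (mevalX_neq0 _ x0)) orbF => /eqP fa.
    by have := ca a; rewrite E inE eqxx fa eqxx => /(_ isT).
  exists a, b; rewrite !inE !eqxx orbT; split=> //.
  by move: us; rewrite /= inE negb_or => /andP[/andP[]].
have [H|/existsNP[h /not_implyP[h0 /not_implyP[hX /eqP hab]]]] := pselect (forall h,
  full_support h ->
   (forall v, v != 0 -> X (pt v) -> X (pt (mulv h v))) -> ('X_[a] : form).@[h 0] = 'X_[b].@[h 0]).
  by exists a, b; split; rewrite ?hm.
(* These are the coefficients of a(h) f(v) - f(h v), where a(h) is the value at h of the monomial a.
   This form vanishes on X, loses the monomial a and keeps b. *)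
pose c j := f@_j * (('X_[a] : form).@[h 0] - 'X_[j].@[h 0]).
pose r := [seq j <- msupp f | ('X_[a] : form).@[h 0] != 'X_[j].@[h 0]].
pose g : form := \sum_(j <- r) c j *: 'X_[j].
have pg : perm_eq (msupp g) r.
  apply: msupp_sumX; first exact: filter_uniq.
  by move=> j; rewrite mem_filter => /andP[hj /ca fj]; rewrite mulf_neq0 // subr_eq0.
apply: (IH g).
- rewrite (perm_size pg) size_filter; apply: (@leq_trans (size (msupp f))); last by rewrite -ltnS.
  rewrite -(count_predC (pred1 a)).
  rewrite -addn1 addnC leq_add //.
    by rewrite -has_count has_pred1.
  by apply: sub_count => j /=; apply: contra => /eqP ->.
- rewrite /g big_seq; apply: rpred_sum => j; rewrite mem_filter => /andP[_ /hm mj].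
  by apply: rpredZ; rewrite dhomogX /=; apply/eqP.
- apply/eqP => g0; have : b \in msupp g by rewrite (perm_mem pg) mem_filter hab.
  by rewrite g0 msupp0.
move=> v v0 Xv; have fv := fX v v0 Xv; have fhv := fX _ (mulv_neq0 h0 v0) (hX v v0 Xv).
transitivity (\sum_(j <- msupp f) c j * ('X_[j] : form).@[v 0]).
  rewrite rmorph_sum /r big_filter big_mkcond; apply: eq_bigr => j _ /=.
  by case: eqP => [E|_] /=; rewrite ?mevalZ // /c E subrr mulr0 mul0r.
transitivity (('X_[a] : form).@[h 0] * f.@[v 0] - f.@[(mulv h v) 0]); last first.
  by rewrite fv fhv mulr0 subr0.
rewrite {2 3}[f]mpolyE !rmorph_sum mulr_sumr -sumrB; apply: eq_bigr => j _ /=.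
rewrite !mevalZ mevalX_mulv /c mulrBr mulrBl -!mulrA; congr (_ - _).
by rewrite mulrCA.
Qed.

End Torus.

(** * Dimension of Hadamard products *)

Section Hadamard.
Variables (K : fieldType) (n : nat).
Local Notation V := 'rV[K]_n.+1.
Local Notation form := {mpoly K[n.+1]}.
Implicit Types (f g : form) (h q u v w : V) (A B X Y : set (projspace K n)).

Hypothesis Kclosed : forall p : {poly K}, size p != 1 -> exists x, root p x.

Lemma closed_hadamard X Y : zariski_closed (hadamard X Y).
Proof.
by apply: (closed_bigcap Kclosed) => B [].
Qed.

Lemma hadamard_mulv X Y u v : u != 0 -> v != 0 -> mulv u v != 0 ->
  X (pt u) -> Y (pt v) -> hadamard X Y (pt (mulv u v)).
Proof.
move=> u0 v0 uv0 Xu Yv; apply: sub_gen_smallest; exists (pt u) => //; exists (pt v) => //.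
have := hadamard_pt_pi (Sub u u0 : nzvec K n) (Sub v v0 : nzvec K n).
by rewrite -!pt_val /= => ->; rewrite insubT /= -pt_val.
Qed.

Lemma vanishes_on_hadamard d f X Y : f \is d.-homog ->
  (forall u v, u != 0 -> v != 0 -> mulv u v != 0 -> X (pt u) -> Y (pt v) ->
     f.@[(mulv u v) 0] = 0) ->
  vanishes_on f (hadamard X Y).
Proof.
move=> hf H; have [B cB EB] := closed_zero hf.
suff HB : hadamard X Y `<=` B by move=> v v0 /HB /(EB _ v0).
apply: smallest_sub => // R [P XP [Q YQ]]; rewrite /hadamard_pt.
case: insubP => [w w0 Ew|//] [<-]; rewrite -pt_val; apply/EB; first exact: (valP w).
have E : val w = mulv (val (repr P)) (val (repr Q)) by rewrite Ew; apply/rowP => k; rewrite !mxE.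
rewrite E; apply: H; rewrite ?pt_repr -?E //; first exact: (valP (repr P)).
  exact: (valP (repr Q)).
exact: (valP w).
Qed.

Lemma hilbert_le_hadamard X Y m N N' : hilbert_le X m N -> hilbert_le Y m N' ->
  hilbert_le (hadamard X Y) m (N * N').
Proof.
move=> [I [s [cI hs sp]]] [J [t [cJ ht tp]]].
have /choice[al Hal] (a : 'X_{1..n.+1}) : exists c : I -> K,
    mdeg a = m -> vanishes_on ('X_[a] - \sum_i c i *: s i) X.
  have [am|am] := pselect (mdeg a = m); last by exists (fun=> 0).
  by have [|c Hc] := sp 'X_[a]; [rewrite dhomogX; exact/eqP | exists c].
have /choice[be Hbe] (a : 'X_{1..n.+1}) : exists c : J -> K,
    mdeg a = m -> vanishes_on ('X_[a] - \sum_i c i *: t i) Y.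
  have [am|am] := pselect (mdeg a = m); last by exists (fun=> 0).
  by have [|c Hc] := tp 'X_[a]; [rewrite dhomogX; exact/eqP | exists c].
(* The coordinates of (u, v) |-> f(u v) on the products s_i(u) t_j(v), obtained by expanding each
   monomial separately on X and on Y. *)
pose e f (p : I * J) := \sum_(a <- msupp f) f@_a * (al a p.1 * be a p.2).
have He f u v : f \is m.-homog -> u != 0 -> v != 0 -> X (pt u) -> Y (pt v) ->
    f.@[(mulv u v) 0] = \sum_p e f p * ((s p.1).@[u 0] * (t p.2).@[v 0]).
  move=> /dhomogP hf u0 v0 Xu Yv; rewrite {1}[f]mpolyE rmorph_sum /=.
  under [RHS]eq_bigr do rewrite mulr_suml.
  rewrite exchange_big /=; apply: eq_big_seq => a /hf ma.
  rewrite mevalZ mevalX_mulv.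
  have /eqP := Hal a ma u u0 Xu; rewrite mevalB subr_eq0 => /eqP ->.
  have /eqP := Hbe a ma v v0 Yv; rewrite mevalB subr_eq0 => /eqP ->.
  rewrite !rmorph_sum mulr_suml mulr_sumr /=.
  rewrite -(pair_bigA _ (fun i j => f@_a * (al a i * be a j) * ((s i).@[u 0] * (t j).@[v 0]))) /=.
  apply: eq_bigr => i _; rewrite !mulr_sumr; apply: eq_bigr => j _.
  by rewrite !mevalZ -mulrA mulrACA.
apply: free_hilbert_le => r F hF frF; rewrite leqNgt; apply/negP => Nr.
have [|c [[j cj] Ec]] := @linear_dependence K (I * J)%type 'I_r (fun k p => e (F k) p).
  by rewrite card_prod card_ord; apply: leq_ltn_trans Nr; exact: leq_mul.
case/eqP: cj; apply: frF; apply: (vanishes_on_hadamard (d := m)).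
  apply: rpred_sum => k _; apply: rpredZ; exact: hF.
move=> u v u0 v0 _ Xu Yv; rewrite rmorph_sum /=.
under eq_bigr do rewrite mevalZ He // mulr_sumr.
rewrite exchange_big big1 //= => p _.
transitivity ((\sum_k c k * e (F k) p) * ((s p.1).@[u 0] * (t p.2).@[v 0]));
  last by rewrite Ec mul0r.
by rewrite [RHS]mulr_suml; apply: eq_bigr => k _; rewrite !mulrA.
Qed.

Lemma hilbert_growth_hadamard X Y d e : hilbert_growth X d -> hilbert_growth Y e ->
  hilbert_growth (hadamard X Y) (d + e).
Proof.
move=> [k Hk] [l Hl]; exists (k * l)%N => m; rewrite expnD mulnACA.
exact: hilbert_le_hadamard.
Qed.

(** If f and g are both non-zero at some product, irreducibility of X gives a common first factor w,
    and then irreducibility of Y a common second factor z. *)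
Lemma integral_hadamard X Y x y : integral_variety X -> integral_variety Y ->
  full_support x -> X (pt x) -> full_support y -> Y (pt y) ->
  integral_variety (hadamard X Y).
Proof.
move=> [_ /irreducibleP[_ iX]] [_ /irreducibleP[_ iY]] x0 Xx y0 Yy.
split; first exact: closed_hadamard.
have xn0 := full_support_neq0 x0; have yn0 := full_support_neq0 y0.
apply/irreducibleP; split.
  by exists (pt (mulv x y)); apply: hadamard_mulv => //; exact: mulv_neq0.
pose nz f := exists u v, [/\ u != 0, v != 0, X (pt u), Y (pt v) & f.@[(mulv u v) 0] != 0].
have nzM d e f g : f \is d.-homog -> g \is e.-homog -> nz f -> nz g -> nz (f * g).
  move=> hf hg [u [v [u0 v0 Xu Yv fuv]]] [u' [v' [u'0 v'0 Xu' Yv' guv]]].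
  have [f1 hf1 Ef1] := homog_mulv v hf; have [g1 hg1 Eg1] := homog_mulv v' hg.
  have [w [w0 Xw]] : exists w, [/\ w != 0, X (pt w) & (f1 * g1).@[w 0] != 0].
    apply: not_vanishes_on => /(iX _ _ _ _ hf1 hg1)[H|H].
      by move: fuv; rewrite mulvC -Ef1 H ?eqxx.
    by move: guv; rewrite mulvC -Eg1 H ?eqxx.
  rewrite mevalM mulf_eq0 negb_or Ef1 Eg1 => /andP[fw gw].
  have [f2 hf2 Ef2] := homog_mulv w hf; have [g2 hg2 Eg2] := homog_mulv w hg.
  have [z [z0 Yz]] : exists z, [/\ z != 0, Y (pt z) & (f2 * g2).@[z 0] != 0].
    apply: not_vanishes_on => /(iY _ _ _ _ hf2 hg2)[H|H].
      by move: fw; rewrite mulvC -Ef2 H ?eqxx.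
    by move: gw; rewrite mulvC -Eg2 H ?eqxx.
  by rewrite mevalM Ef2 Eg2 -mevalM => fgz; exists w, z.
(* Multiplying f by ['X_0] forces the product vector to be non-zero, which f alone does not ensure
   in degree 0. *)
have nzX : nz 'X_0 by exists x, y; split=> //; rewrite mevalXU mxE mulf_neq0.
have nzP d f : f \is d.-homog -> nz f -> ~ vanishes_on f (hadamard X Y).
  move=> hf nf; have [u [v [u0 v0 Xu Yv]]] := nzM _ _ _ _ hf (hom_X _ 0) nf nzX.
  rewrite mevalM mevalXU mulf_eq0 negb_or => /andP[fuv uv0] fH.
  case/eqP: fuv; apply: fH.
    by apply: contraNneq uv0 => ->; rewrite mxE.
  apply: hadamard_mulv => //.
  by apply: contraNneq uv0 => ->; rewrite mxE.
have Pnz d f : f \is d.-homog -> ~ vanishes_on f (hadamard X Y) -> nz f.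
  move=> hf nf; apply: contrapT => H; apply: nf.
  apply: (vanishes_on_hadamard hf) => u v u0 v0 _ Xu Yv; apply/eqP.
  by apply: contra_notT H => fuv; exists u, v.
move=> d e f g hf hg fg; apply: contrapT => /not_orP[/(Pnz _ _ hf) nf /(Pnz _ _ hg) ng].
exact: nzP (dhomogM hf hg) (nzM _ _ _ _ hf hg nf ng) fg.
Qed.

(** The chain whose length is the growth order attains the upper bound on lengths, so the default
    value of [krull_dim] does not occur. *)
Lemma krull_dimP A : integral_variety A ->
  is_krull_dim A (krull_dim A) /\ hilbert_growth A (krull_dim A).
Proof.
move=> /(chain_hilbert_growth Kclosed)[d [[C cC] gA]].
have dA : is_krull_dim A d by split=> [|e C' /(chain_growth gA)]; [exists C|].
have kA : is_krull_dim A (krull_dim A) by apply: xgetPex; exists d.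
split=> //; suff -> : krull_dim A = d by [].
have [[C1 cC1] H1] := kA; apply/eqP; rewrite eqn_leq.
by rewrite (chain_growth gA cC1) (H1 _ _ cC).
Qed.

Lemma coord_subspaceT : coord_subspace finset.setT = [set: projspace K n].
Proof. by apply/seteqP; split=> // P _ j; rewrite finset.in_setT. Qed.

(** For q in Y off the coordinate hyperplanes, q X lies in the product of X and Y, hence in y X, so
    q / y maps X into itself. Two monomials a and b then agree at q / y, which reads b(y) a(q) =
    a(y) b(q). *)
Lemma sub_binomial_hypersurface X Y m f x y : integral_variety Y ->
  full_support x -> X (pt x) -> full_support y -> Y (pt y) ->
  f \is m.-homog -> f != 0 -> vanishes_on f X ->
  (forall q, full_support q -> Y (pt q) -> hadamard X Y `<=` translate q X) ->
  exists2 B, binomial_hypersurface B & Y `<=` B.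
Proof.
move=> [_ iY] x0 Xx y0 Yy hf f0 fX HXY.
have [a [b [ab ma mb Hab]]] := stabilizer_character x0 Xx hf f0 fX.
pose g : form := 'X_[b].@[y 0] *: 'X_[a] + - 'X_[a].@[y 0] *: 'X_[b].
have hg : g \is m.-homog by apply: rpredD; apply: rpredZ; rewrite dhomogX; exact/eqP.
exists (zeros [set g]).
  exists ('X_[b].@[y 0]), (- 'X_[a].@[y 0]), a, b; split; rewrite ?oppr_eq0 ?mevalX_neq0 //.
  by rewrite ma.
have gY q : full_support q -> Y (pt q) -> g.@[q 0] = 0.
  move=> q0 Yq; have h0 : full_support (mulv (invv y) q).
    by move=> k; rewrite !mxE mulf_neq0 ?invr_eq0.
  have := Hab _ h0; rewrite !mevalX_mulv !mevalX_inv mevalD !mevalZ => H.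
  rewrite mulNr; apply/eqP; rewrite subr_eq0; apply/eqP.
  have {}H : ('X_[a].@[y 0])^-1 * 'X_[a].@[q 0] = ('X_[b].@[y 0])^-1 * ('X_[b] : form).@[q 0].
    apply: H => v v0 Xv; have qv0 := mulv_neq0 q0 v0.
    rewrite -mulvA; apply/(translate_pt _ y0 qv0)/(HXY y y0 Yy).
    by rewrite mulvC; apply: hadamard_mulv => //; [exact: full_support_neq0 | rewrite mulvC].
  by rewrite -[('X_[b] : form).@[q 0]](mulVKf (mevalX_neq0 b y0)) -H mulrCA mulVKf ?mevalX_neq0.
(* The product of all coordinates does not vanish at y; by irreducibility, the equation passes from
   the points of Y with full support to all of Y. *)
pose one := [multinom 1%N | k < n.+1].
have ho : ('X_[one] : form) \is (mdeg one).-homog by rewrite dhomogX.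
have nzo v : ('X_[one] : form).@[v 0] != 0 -> full_support v.
  rewrite mevalX => /prodf_neq0 H k; have := H k isT; by rewrite mnmE expr1.
have gvan : vanishes_on g Y.
  apply: (irreducible_cancel iY ho hg).
    by move/(_ y (full_support_neq0 y0) Yy)/eqP; rewrite (negPf (mevalX_neq0 _ y0)).
  move=> v v0 Yv; rewrite mevalM; have [->|/nzo vs] := eqVneq ('X_[one].@[v 0]) 0;
    first by rewrite mul0r.
  by rewrite gY // mulr0.
apply: subset_ptP => v v0 Yv; apply/zeros_pt => // [_ ->|_ ->]; first exact: homogE hg.
exact: gvan.
Qed.

Lemma krull_dim_hadamard X Y : integral_variety X -> ~ (X `<=` coord_hyperplanes K n) ->
  integral_curve Y -> ~ (Y `<=` coord_hyperplanes K n) ->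
  (forall B, binomial_hypersurface B -> ~ (Y `<=` B)) ->
  krull_dim (hadamard X Y) = minn n (krull_dim X + 1).
Proof.
move=> iX /ex_full_support[x x0 Xx] [iY dY] /ex_full_support[y y0 Yy] nB.
have iH := integral_hadamard iX iY x0 Xx y0 Yy.
have [[[CX cX] maxX] gX] := krull_dimP iX; have [_ gY] := krull_dimP iY.
have [[[CH cH] maxH] _] := krull_dimP iH.
rewrite dY in gY.
have le1 := chain_growth (hilbert_growth_hadamard gX gY) cH.
have cT : #|finset.setT : {set 'I_n.+1}| = n.+1 by rewrite finset.cardsT card_ord.
have gT : hilbert_growth [set: projspace K n] n.
  by rewrite -coord_subspaceT; exact: hilbert_growth_coord_subspace.
have len : (krull_dim (hadamard X Y) <= n)%N.
  by have [iC sC _] := cH; apply: (chain_growth (Z := CH) gT); split.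
have trX q : full_support q -> Y (pt q) -> translate q X `<=` hadamard X Y.
  move=> q0 Yq Q [v [v0 Xv ->]]; rewrite mulvC; apply: hadamard_mulv => //.
    exact: full_support_neq0.
  by rewrite mulvC mulv_neq0.
(* If X is the whole space, its translate by y shows that the product has dimension n. *)
have [XT|/not_subset_ptP[w [w0 _ nXw]]] := pselect ([set: projspace K n] `<=` X).
  have Xn : (n <= krull_dim X)%N.
    have [C cC] := chain_coord_subspace Kclosed cT; apply: (maxX _ C).
    by case: cC => iC sC _; split=> // P _; exact: XT.
  have ge : (krull_dim X <= krull_dim (hadamard X Y))%N.
    have [iC sC CX'] := chain_translate y0 cX.
    by apply: (maxH _ _); split; [exact: iC | exact: sC | apply: subset_trans (trX y y0 Yy)].
  by lia.
have [m [f [hf fX fw]]] := separation iX.1 w0 nXw.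
have f0 : f != 0 by apply: contraNneq fw => ->; rewrite meval0.
have [q [q0 Yq nq]] : exists q, [/\ full_support q, Y (pt q) & ~ (hadamard X Y `<=` translate q
  X)].
  apply: contrapT => H; have [|B bB YB] := sub_binomial_hypersurface iY x0 Xx y0 Yy hf f0 fX.
    by move=> q q0 Yq; apply: contrapT => nq; apply: H; exists q.
  exact: nB bB YB.
(* The translate by q of a longest chain of X lies in q X, a proper subset of the product, which can
   therefore be added on top. *)
have ge : ((krull_dim X).+1 <= krull_dim (hadamard X Y))%N.
  apply: (maxH _ _ _); apply: chain_append (chain_translate q0 cX) iH _.
  by split=> //; exact: trX.
by lia.
Qed.

End Hadamard.

End Dimension.

Theorem theorem1p4 (R : realType) (n : nat) (X Y : set (CP R n)) :
  integral_variety X ->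
  ~ (X `<=` coord_hyperplanes R[i] n) ->
  integral_curve Y ->
  ~ (Y `<=` coord_hyperplanes R[i] n) ->
  (forall B, binomial_hypersurface B -> ~ (Y `<=` B)) ->
  krull_dim (hadamard X Y) = minn n (krull_dim X + 1).
Proof.
by apply: krull_dim_hadamard => p /closed_rootP.
Qed.
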